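(* In the self-oscillator computing setting described in the context, fix $l\in\mathbb N_{\ge0}$ and consider the dynamics during the $l$-th isentropic time interval $[\tau_l,\tau_l+t_{\max,l})$. There are universal positive numerical constants $\kappa,c_0$ such that, with $\lambda=4.64$, for all $\varepsilon^{\mathrm{gate}}\in[0,1/2]$ the gate frequency $f$ during this interval satisfies: Case 1) if $\rho_{\mathrm{SC}}(\tau_l|\tau_l)\in\mathcal C^{\mathrm{clas.},l}_{\mathrm{SC}}$, then $f\le\frac{\sqrt{T_0^2P^{\mathrm{in}}_l+\varepsilon^0_{\mathrm H}}}{(\lambda+1)c_0T_0}$; Case 2) in general, $f\le\frac{T_0^2P^{\mathrm{in}}_l+\varepsilon^0_{\mathrm H}}{(\lambda+1)\kappa T_0}$.
   Context: Units $\hbar=1$; $T_0>0$ is the cycle time. Self-oscillator setting: $\mathcal H_{\mathrm S}=\mathcal H_{\mathrm L}\otimes\mathcal H_{\mathrm{S\setminus L}}$ and $\mathcal H_{\mathrm C}$ finite-dimensional; $H_{\mathrm{SC}}$ self-adjoint on $\mathcal H_{\mathrm S}\otimes\mathcal H_{\mathrm C}$ with smallest eigenvalue $0$; finitely many operators $J^j_{\mathrm C}$ on $\mathcal H_{\mathrm C}$, $V_{\mathrm C}:=\tfrac12\sum_jJ^{j\dagger}_{\mathrm C}J^j_{\mathrm C}=\sum_jv_j|v_j\rangle\langle v_j|$. Renewal map $\mathcal D^{\mathrm{re}}_{\mathrm C}(X):=\sum_j(\mathbb 1\otimes J^j_{\mathrm C})X(\mathbb 1\otimes J^j_{\mathrm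 C})^\dagger$, assumed such that for a fixed density matrix $\rho^0_{\mathrm C}$, $\sum_jJ^j_{\mathrm C}\sigma J^{j\dagger}_{\mathrm C}$ is a nonnegative multiple of $\rho^0_{\mathrm C}$ for all density matrices $\sigma$. $\mathcal L^{\mathrm{no\,re}}(X):=-i[H_{\mathrm{SC}},X]-\{\mathbb 1\otimes V_{\mathrm C},X\}$. Renewal times $0=\tau_0<\tau_1<\cdots$; $\rho_{\mathrm{SC}}(\tau_0|\tau_0):=\rho_{\mathrm S}(0)\otimes\rho^0_{\mathrm C}$; $\rho_{\mathrm{SC}}(\!(t+\tau_l|\tau_l)\!):=e^{t\mathcal L^{\mathrm{no\,re}}}(\rho_{\mathrm{SC}}(\tau_l|\tau_l))$ for $t\ge0$; for $l\ge1$, $\rho_{\mathrm{SC}}(\tau_l|\tau_l)$ is $\mathcal D^{\mathrm{re}}_{\mathrm C}(\rho_{\mathrm{SC}}(\!(\tau_l|\tau_{l-1})\!))$ normalized to unit trace; $\rho_{\mathrm{SC}}(t+\tau_l|\tau_l)$ is the unit-trace normalization of $\rho_{\mathrm{SC}}(\!(t+\tau_l|\tau_l)\!)$, $\rho_{\mathrm L}(t+\tau_l|\tau_l)$ its reduced state on $\mathrm L$. $P(t+\tau_l,+1|\tau_l):=\mathrm{tr}[\mathcal D^{\mathrm{re}}_{\mathrm C}(\rho_{\mathrm{SC}}(\!(t+\tau_l|\tau_l)\!))]$, assumed to integrate to $1$ over $t\in[0,\infty)$, with universally bounded first moments $\int_0^\infty tP(t+\tau_l,+1|\tau_l)dt\le\mathbb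 M(1)<\infty$ for all $l$. Power consumed in cycle $l$: $P^{\mathrm{in}}_l:=\frac1{T_0}\int_0^\infty\mathrm{tr}[H_{\mathrm{SC}}\mathcal D^{\mathrm{re}}_{\mathrm C}(\rho_{\mathrm{SC}}(\!(s+\tau_l|\tau_l)\!))]ds$. Instantaneous initial-cycle-state parameter: for a Hermitian $H_{\mathrm C}$ on $\mathcal H_{\mathrm C}$ and $\tilde H_{\mathrm{SC}}:=H_{\mathrm{SC}}-\mathbb 1\otimes H_{\mathrm C}$, $\varepsilon^0_{\mathrm H}$ is any real number with $\|\mathrm{tr}_{\mathrm C}[\tilde H_{\mathrm{SC}}(\mathbb 1\otimes\rho^0_{\mathrm C})]\|_F\|\tilde H_{\mathrm{SC}}\|_F\,2\,\mathbb M(1)T_0\le\varepsilon^0_{\mathrm H}$ ($\|\cdot\|_F$ Frobenius norm). Quality: $p_j(t,l):=\mathrm{tr}[(\mathbb 1\otimes|v_j\rangle\langle v_j|)\rho_{\mathrm{SC}}(\!(t+\tau_l|\tau_l)\!)]$, $\varepsilon^{\mathrm{quality}}_l(\tau):=\int_0^\tau(\sum_jv_j^2p_j(t,l))^{1/2}dt$. Gates: in cycle $l$ the logical state should pass through orthonormal $|1,l\rangle_{\mathrm L},|2,l\rangle_{\mathrm L},\dots$ (spanning $\mathcal H_{\mathrm L}$) at times $t_j=jt_1$ after $\tau_l$, with $T(\rho_{\mathrm L}(t_j+\tau_l|\tau_l),|j,l\rangle_{\mathrm L})\le\varepsilon^{\mathrm{gate}}$ ($T$ = trace distance) for all $j\in\mathbb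 Z_{>0}$ with $t_j\in(0,t_{\max,l})$; the gate frequency is $f:=1/t_1$. Isentropic interval: $t_{\max,l}\ge0$ is the largest number with $\frac1{4(1+\lambda)^2}=\varepsilon^{\mathrm{gate}}(2-\varepsilon^{\mathrm{gate}})+2\varepsilon^{\mathrm{quality}}_l(t_{\max,l})\sqrt{1-\varepsilon^{\mathrm{gate}}}$, $\lambda=4.64$. Semi-classical states: $\mathcal C(A,B)$ (for Hermitian dimensionless $A,B$) is the set of $\mathrm{tr}_{\mathrm P}[|\psi\rangle\langle\psi|]$ with $|\psi\rangle$ a normalized eigenvector of $(\lambda'A+iB)\otimes\mathbb 1_{\mathrm P}$ for some $|\lambda'|=1$, finite-dimensional ancilla $\mathrm P$; with $\bar M^{(j,l)}_{\mathrm L}:=\frac1{T_0}\sum_kt_1(1-\delta_{k,j})|k,l\rangle\langle k,l|_{\mathrm L}$ and $\bar H_{\mathrm{SC}}:=T_0H_{\mathrm{SC}}$, $\rho_{\mathrm{SC}}(\tau_l|\tau_l)\in\mathcal C^{\mathrm{clas.},l}_{\mathrm{SC}}$ iff there is $j$ with $t_j,t_{j+1}\in[0,t_{\max,l})$, $\rho_{\mathrm{SC}}(t_j+\tau_l|\tau_l)\in\mathcal C(\bar M^{(j,l)}_{\mathrm L},\bar H_{\mathrm{SC}})$ and $\rho_{\mathrm{SC}}(t_{j+1}+\tau_l|\tau_l)\in\mathcal C(\bar M^{(j+1,l)}_{\mathrm L},\bar H_{\mathrm{SC}})$. The setting presupposes that gates are actually applied during the interval, i.e. there is $j\ge1$ with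 $t_{j+1}<t_{\max,l}$. *)

(* Defs.v *)
(* Scalars: complex numbers R[i]
   (mathcomp-real-closed) over an abstract real field R : realType.
   Finite-dimensional Hilbert spaces are C^d, operators are 'M[R[i]]_d,
   tensor products are Kronecker products (mxtens), index conventions:
   H_S = H_L (x) H_{S\L}  (dimension dL * dR),
   H_S (x) H_C            (dimension (dL * dR) * dC). *)
From HB Require Import structures.
From mathcomp Require Import all_boot all_order all_algebra.
From mathcomp Require Import all_classical all_reals all_analysis.
From mathcomp.real_closed Require Export complex mxtens.

Set Implicit Arguments.
Unset Strict Implicit.
Unset Printing Implicit Defensive.

Import Order.TTheory GRing.Theory Num.Theory.
Import numFieldNormedType.Exports.
Local Open Scope ring_scope.
Local Open Scope classical_set_scope.
Local Open Scope complex_scope.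

Section QDefs.
Variable R : realType.
Local Notation C := R[i].

Definition iC : C := @Complex R 0 1.

Definition dag m n (A : 'M[C]_(m, n)) : 'M[C]_(n, m) := (map_mx Num.conj A)^T.

Definition herm n (A : 'M[C]_n) : Prop := dag A = A.

Definition psd_mx n (A : 'M[C]_n) : Prop :=
  herm A /\ forall v : 'cV[C]_n, 0 <= (dag v *m A *m v) 0 0.

Definition density_mx n (A : 'M[C]_n) : Prop := psd_mx A /\ \tr A = 1.

Definition ketbra n (v : 'cV[C]_n) : 'M[C]_n := v *m dag v.

Definition orthonormal_fam n k (e : 'I_k -> 'cV[C]_n) : Prop :=
  forall a b : 'I_k, (dag (e a) *m e b) 0 0 = (a == b)%:R.

Definition ptr2 m n (X : 'M[C]_(m * n)) : 'M[C]_m :=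
  \matrix_(i, j) \sum_(k < n) X (mxtens_index (i, k)) (mxtens_index (j, k)).

Definition tr_normalize n (X : 'M[C]_n) : 'M[C]_n := (\tr X)^-1 *: X.

Definition frob m n (A : 'M[C]_(m, n)) : R :=
  Num.sqrt (\sum_(i < m) \sum_(j < n)
              ((complex.Re (A i j)) ^+ 2 + (complex.Im (A i j)) ^+ 2)).

(** trace norm ||A||_1 = tr sqrt(A^dagger A) = sum of the square roots of the
    eigenvalues (with multiplicity) s_1..s_n of A^dagger A *)
Definition is_trnorm n (A : 'M[C]_n) (r : R) : Prop :=
  exists s : 'I_n -> C,
    char_poly (dag A *m A) = \prod_(i < n) ('X - (s i)%:P) /\
    r%:C = \sum_(i < n) sqrtC (s i).

Definition trdist_le n (rho sigma : 'M[C]_n) (e : R) : Prop :=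
  exists r, is_trnorm (rho - sigma) r /\ r / 2 <= e.

(** E is the flow of the linear ODE  d/dt X(t) = Lg (X(t)), i.e. E t = e^{t Lg}
    (the unique such flow); derivatives taken entrywise on real and imaginary
    parts *)
Definition is_flow n (Lg : 'M[C]_n -> 'M[C]_n) (E : R -> 'M[C]_n -> 'M[C]_n) :=
  forall X : 'M[C]_n, E 0 X = X /\
    forall (t : R) (i j : 'I_n),
      is_derive t 1 (fun s => complex.Re (E s X i j)) (complex.Re (Lg (E t X) i j)) /\
      is_derive t 1 (fun s => complex.Im (E s X i j)) (complex.Im (Lg (E t X) i j)).

Section Setting.
Variables (dL dR dC nJ : nat).
Local Notation dS := (dL * dR)%N.
Local Notation dSC := (dS * dC)%N.
Variable (J : 'I_nJ -> 'M[C]_dC).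

Definition VC : 'M[C]_dC := (2^-1 : C) *: \sum_(j < nJ) dag (J j) *m J j.

Definition Lnore (Hsc : 'M[C]_dSC) (X : 'M[C]_dSC) : 'M[C]_dSC :=
  - (iC *: (Hsc *m X - X *m Hsc))
  - ((1%:M *t VC) *m X + X *m (1%:M *t VC)).

Definition Dre (X : 'M[C]_dSC) : 'M[C]_dSC :=
  \sum_(j < nJ) ((1%:M : 'M[C]_dS) *t J j) *m X *m dag ((1%:M : 'M[C]_dS) *t J j).

Variables (E : R -> 'M[C]_dSC -> 'M[C]_dSC) (tau : nat -> R)
          (rhoS0 : 'M[C]_dS) (rho0C : 'M[C]_dC).

Fixpoint init_state (l : nat) : 'M[C]_dSC :=
  match l with
  | 0 => rhoS0 *t rho0C
  | l'.+1 => tr_normalize (Dre (E (tau l'.+1 - tau l') (init_state l')))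
  end.

Definition unnorm_state (l : nat) (t : R) : 'M[C]_dSC := E t (init_state l).

Definition cycle_state (l : nat) (t : R) : 'M[C]_dSC := tr_normalize (unnorm_state l t).

Definition stateL (l : nat) (t : R) : 'M[C]_dL := ptr2 (ptr2 (cycle_state l t)).

(** P(t + tau_l, +1 | tau_l) (a real number: trace of a psd_mx operator) *)
Definition Pren (l : nat) (t : R) : R := complex.Re (\tr (Dre (unnorm_state l t))).

Definition Pin (T0 : R) (Hsc : 'M[C]_dSC) (l : nat) : R :=
  T0^-1 * Rintegral (@lebesgue_measure R) `[0%R, +oo[
            (fun s => complex.Re (\tr (Hsc *m Dre (unnorm_state l s)))).

(** p_j(t, l) for the eigen-decomposition V_C = sum_j v_j |v_j><v_j| *)
Definition pj (u : 'I_dC -> 'cV[C]_dC) (j : 'I_dC) (l : nat) (t : R) : R :=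
  complex.Re (\tr (((1%:M : 'M[C]_dS) *t ketbra (u j)) *m unnorm_state l t)).

Definition eps_quality (v : 'I_dC -> R) (u : 'I_dC -> 'cV[C]_dC) (l : nat) (tt : R) : R :=
  Rintegral (@lebesgue_measure R) `[0%R, tt]
    (fun t => Num.sqrt (\sum_(j < dC) (v j) ^+ 2 * pj u j l t)).

Definition lambda464 : R := 464%:R / 100%:R.

Definition tmax_eq (epsg : R) (v : 'I_dC -> R) (u : 'I_dC -> 'cV[C]_dC) (l : nat) (t : R) :=
  (4 * (1 + lambda464) ^+ 2)^-1 =
     epsg * (2 - epsg) + 2 * eps_quality v u l t * Num.sqrt (1 - epsg).

Definition is_tmax epsg v u l (tm : R) : Prop :=
  0 <= tm /\ tmax_eq epsg v u l tm /\
  forall t, 0 <= t -> tmax_eq epsg v u l t -> t <= tm.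

(** \bar M^{(j,l)}_L = (1/T0) sum_k t_1 (1 - delta_{k,j}) |k,l><k,l|,
    where the gate cycle_state |k,l> (k = 1, 2, ...) is g (k - 1) *)
Definition Mbar (T0 t1 : R) (g : 'I_dL -> 'cV[C]_dL) (j : nat) : 'M[C]_dL :=
  (T0^-1)%:C *: \sum_(k < dL) (t1 * (1 - (k.+1 == j)%:R))%:C *: ketbra (g k).

Definition liftL (A : 'M[C]_dL) : 'M[C]_dSC :=
  (A *t (1%:M : 'M[C]_dR)) *t (1%:M : 'M[C]_dC).

End Setting.

Definition semiclassical n (A B : 'M[C]_n) (rho : 'M[C]_n) : Prop :=
  exists (dP : nat) (psi : 'cV[C]_(n * dP)) (lam' mu : C),
    dag psi *m psi = 1%:M /\ `|lam'| = 1 /\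
    ((lam' *: A + iC *: B) *t (1%:M : 'M[C]_dP)) *m psi = mu *: psi /\
    rho = ptr2 (ketbra psi).

End QDefs.

(* Main.v *)
(** Between renewals the state is Psi(t) Psi(t)^dag with Psi(t) = exp(-t(iH + V)) Y for a
    purification Y of the initial cycle state, so its distance to the unitary evolution
    Phi(t) = exp(-itH) Y is at most the integral of |V Psi|, which is the quality
    parameter. The isentropic condition thus keeps Phi within a small error of the gate
    states, and consecutive Phi's are almost orthogonal.

    By Cauchy-Schwarz for the nonnegative form H, Re <Phi, e^{-itH} Phi> >= 1 - t <H>, and
    <H> is conserved; hence t1 <H> is bounded below by a constant, <H> being the energy of
    the initial cycle state. A renewal resets C to rho0C, so that energy equals
    T0 Pin up to the work done by the interaction on S during the cycle; the latter is at
    most 2 |A| |H~| times the integral of the survival probability, i.e. times the first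
    moment of the renewal time. This gives case 2.

    In case 1 the eigenvector equation makes the spread of T0 H equal to that of the
    gate observable Mbar, hence at most t1/T0. On the other hand the spread of H times t1 is
    bounded below by a constant, because the overlap decays at most at the rate of the
    spread. So T0/t1 is bounded, and case 2 upgrades to the square-root bound. *)
Require Import Defs.
From HB Require Import structures.
From mathcomp Require Import all_boot all_order all_algebra.
From mathcomp Require Import all_classical all_reals all_analysis.
From mathcomp.real_closed Require Import complex mxtens.
From mathcomp Require Import spectral sesquilinear measurable_realfun ring lra.
Import Order.TTheory GRing.Theory Num.Theory.
Import numFieldNormedType.Exports.
Local Open Scope ring_scope.
Local Open Scope classical_set_scope.
Local Open Scope complex_scope.

Set Implicit Arguments.
Unset Strict Implicit.
Unset Printing Implicit Defensive.

(** * Complex matrices with the real inner product Re tr(X^dag Y) *)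
Section LinearAlgebra.
Variable R : realType.
Local Notation C := R[i].
Local Notation Re := (@complex.Re R).
Local Notation Im := (@complex.Im R).

Lemma complex_ext (x y : C) : Re x = Re y -> Im x = Im y -> x = y.
Proof. by case: x => a b; case: y => c d /= -> ->. Qed.

Lemma ReD (x y : C) : Re (x + y) = Re x + Re y.
Proof. by case: x => a b; case: y. Qed.
Lemma ImD (x y : C) : Im (x + y) = Im x + Im y.
Proof. by case: x => a b; case: y. Qed.
Lemma ReN (x : C) : Re (- x) = - Re x.
Proof. by case: x. Qed.
Lemma ImN (x : C) : Im (- x) = - Im x.
Proof. by case: x. Qed.
Lemma ReM (x y : C) : Re (x * y) = Re x * Re y - Im x * Im y.
Proof. by case: x => a b; case: y. Qed.
Lemma ImM (x y : C) : Im (x * y) = Re x * Im y + Im x * Re y.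
Proof. by case: x => a b; case: y => c d /=; rewrite addrC. Qed.
Lemma ReJ (x : C) : Re (Num.conj x) = Re x.
Proof. by case: x. Qed.
Lemma ImJ (x : C) : Im (Num.conj x) = - Im x.
Proof. by case: x. Qed.
Lemma ReC (a : R) : Re a%:C = a. Proof. by []. Qed.
Lemma ImC (a : R) : Im a%:C = 0. Proof. by []. Qed.
Lemma ReCM (a : R) (x : C) : Re (a%:C * x) = a * Re x.
Proof. by rewrite ReM ReC ImC mul0r subr0. Qed.
Lemma Re_sum (I : Type) (r : seq I) (P : pred I) (F : I -> C) :
  Re (\sum_(i <- r | P i) F i) = \sum_(i <- r | P i) Re (F i).
Proof. exact: (big_morph _ ReD (erefl _)). Qed.
Lemma Im_sum (I : Type) (r : seq I) (P : pred I) (F : I -> C) :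
  Im (\sum_(i <- r | P i) F i) = \sum_(i <- r | P i) Im (F i).
Proof. exact: (big_morph _ ImD (erefl _)). Qed.

Lemma Re_iC : Re (iC R) = 0. Proof. by []. Qed.
Lemma Im_iC : Im (iC R) = 1. Proof. by []. Qed.

Lemma iC_mul_iC : iC R * iC R = -1.
Proof. by apply: complex_ext; rewrite ?ReM ?ImM ?ReN ?ImN /=; lra. Qed.

Lemma conj_iC : Num.conj (iC R) = - iC R.
Proof. by apply: complex_ext; rewrite ?ReJ ?ImJ ?ReN ?ImN /= ?oppr0. Qed.

Lemma conj_real (a : R) : Num.conj (a%:C : C) = a%:C.
Proof. by apply: complex_ext; rewrite ?ReJ ?ImJ ?ImC ?oppr0. Qed.

Lemma dagE m n (A : 'M[C]_(m, n)) i j : dag A i j = Num.conj (A j i).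
Proof. by rewrite !mxE. Qed.

Lemma dagK m n (A : 'M[C]_(m, n)) : dag (dag A) = A.
Proof. by apply/matrixP => i j; rewrite !dagE conjCK. Qed.

Lemma dagD m n (A B : 'M[C]_(m, n)) : dag (A + B) = dag A + dag B.
Proof. by apply/matrixP => i j; rewrite [RHS]mxE !dagE mxE rmorphD. Qed.

Lemma dagN m n (A : 'M[C]_(m, n)) : dag (- A) = - dag A.
Proof. by apply/matrixP => i j; rewrite [RHS]mxE !dagE mxE rmorphN. Qed.

Lemma dagB m n (A B : 'M[C]_(m, n)) : dag (A - B) = dag A - dag B.
Proof. by rewrite dagD dagN. Qed.

Lemma dagZ m n (a : C) (A : 'M[C]_(m, n)) : dag (a *: A) = Num.conj a *: dag A.
Proof. by apply/matrixP => i j; rewrite [RHS]mxE !dagE mxE rmorphM. Qed.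

Lemma dagM m n p (A : 'M[C]_(m, n)) (B : 'M[C]_(n, p)) :
  dag (A *m B) = dag B *m dag A.
Proof. by rewrite /dag map_mxM trmx_mul. Qed.

Lemma dag1 n : dag (1%:M : 'M[C]_n) = 1%:M.
Proof. by rewrite /dag map_scalar_mx rmorph1 tr_scalar_mx. Qed.

Lemma dag_sum m n (I : Type) (r : seq I) (P : pred I) (F : I -> 'M[C]_(m, n)) :
  dag (\sum_(i <- r | P i) F i) = \sum_(i <- r | P i) dag (F i).
Proof.
apply: (big_morph _ (@dagD m n)).
by apply/matrixP => i j; rewrite dagE !mxE rmorph0.
Qed.

Lemma dag_tens m n p q (A : 'M[C]_(m, n)) (B : 'M[C]_(p, q)) :
  dag (A *t B) = dag A *t dag B.
Proof. by rewrite /dag map_mxT trmx_tens. Qed.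

Lemma tensmxDl m n p q (A B : 'M[C]_(m, n)) (D : 'M[C]_(p, q)) :
  (A + B) *t D = A *t D + B *t D.
Proof. by apply/matrixP => i j; rewrite !mxE mulrDl. Qed.

Lemma tensmxDr m n p q (D : 'M[C]_(m, n)) (A B : 'M[C]_(p, q)) :
  D *t (A + B) = D *t A + D *t B.
Proof. by apply/matrixP => i j; rewrite !mxE mulrDr. Qed.

Lemma tensmxZl m n p q a (A : 'M[C]_(m, n)) (D : 'M[C]_(p, q)) :
  (a *: A) *t D = a *: (A *t D).
Proof. by apply/matrixP => i j; rewrite !mxE mulrA. Qed.

Lemma tensmxZr m n p q a (A : 'M[C]_(m, n)) (D : 'M[C]_(p, q)) :
  A *t (a *: D) = a *: (A *t D).
Proof. by apply/matrixP => i j; rewrite !mxE mulrCA. Qed.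

Lemma tensmx_sumr m n p q (I : Type) (r : seq I) (P : pred I)
    (A : 'M[C]_(m, n)) (F : I -> 'M[C]_(p, q)) :
  A *t (\sum_(i <- r | P i) F i) = \sum_(i <- r | P i) A *t F i.
Proof. exact: (big_morph _ (@tensmxDr _ _ _ _ A) (@tensmx0 _ _ _ _ _ A)). Qed.

Lemma tens1mx1 m n : (1%:M : 'M[C]_m) *t (1%:M : 'M[C]_n) = 1%:M.
Proof.
apply/matrixP => i j; case: (mxtens_indexP i) => i1 i2.
case: (mxtens_indexP j) => j1 j2.
by rewrite tensmxE !mxE -natrM mulnb (can_eq (@mxtens_indexK _ _)) xpair_eqE.
Qed.

Lemma mxtens_sum m n (V : nmodType) (F : 'I_(m * n) -> V) :
  \sum_k F k = \sum_i \sum_j F (mxtens_index (i, j)).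
Proof.
rewrite pair_big (reindex (@mxtens_index m n)) /=.
  by apply: eq_bigr => -[i j] _.
by exists (@mxtens_unindex m n) => x _; rewrite ?mxtens_indexK ?mxtens_unindexK.
Qed.

Lemma ptr2_tens m n (A : 'M[C]_m) (B : 'M[C]_n) :
  ptr2 (A *t B) = \tr B *: A.
Proof.
apply/matrixP => i j; rewrite !mxE /mxtrace mulr_suml.
by apply: eq_bigr => k _; rewrite tensmxE mulrC.
Qed.

Lemma mxtrace_mul_ptr2 m n (A : 'M[C]_m) (X : 'M[C]_(m * n)) :
  \tr (A *m ptr2 X) = \tr ((A *t 1%:M) *m X).
Proof.
rewrite /mxtrace [RHS]mxtens_sum; apply: eq_bigr => i _.
rewrite mxE.
under [RHS]eq_bigr => k _.
  rewrite mxE mxtens_sum.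
  under eq_bigr => j _.
    rewrite (bigD1 k) //= big1 ?addr0; last first.
      by move=> k' /negPf nk; rewrite tensmxE !mxE eq_sym nk mulr0 mul0r.
    rewrite tensmxE [1%:M _ _]mxE eqxx mulr1.
    over.
  over.
rewrite exchange_big; apply: eq_bigr => j _.
by rewrite mxE mulr_sumr.
Qed.

Lemma mxtrace_ptr2 m n (X : 'M[C]_(m * n)) : \tr (ptr2 X) = \tr X.
Proof. by rewrite -[ptr2 X]mul1mx mxtrace_mul_ptr2 tens1mx1 mul1mx. Qed.

(** Rectangular arguments let a purification be a matrix whose columns are indexed by the ancilla;
    [rip] is then the real part of the inner product of two such vectors. *)
Definition rip m n (X Y : 'M[C]_(m, n)) : R := Re (\tr (dag X *m Y)).

Lemma ripE m n (X Y : 'M[C]_(m, n)) :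
  rip X Y = \sum_i \sum_j (Re (X i j) * Re (Y i j) + Im (X i j) * Im (Y i j)).
Proof.
rewrite /rip /mxtrace Re_sum exchange_big; apply: eq_bigr => j _.
rewrite mxE Re_sum; apply: eq_bigr => i _.
by rewrite dagE ReM ReJ ImJ mulNr opprK.
Qed.

Lemma ripC m n (X Y : 'M[C]_(m, n)) : rip X Y = rip Y X.
Proof.
by rewrite !ripE; do 2![apply: eq_bigr => ? _]; rewrite mulrC [Im _ * _]mulrC.
Qed.

Lemma ripDr m n (X Y Z : 'M[C]_(m, n)) : rip X (Y + Z) = rip X Y + rip X Z.
Proof. by rewrite /rip mulmxDr mxtraceD ReD. Qed.

Lemma ripNr m n (X Y : 'M[C]_(m, n)) : rip X (- Y) = - rip X Y.
Proof. by rewrite /rip mulmxN raddfN ReN. Qed.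

Lemma ripZr m n a (X Y : 'M[C]_(m, n)) : rip X (a%:C *: Y) = a * rip X Y.
Proof. by rewrite /rip -scalemxAr mxtraceZ ReCM. Qed.

Lemma ripDl m n (X Y Z : 'M[C]_(m, n)) : rip (Y + Z) X = rip Y X + rip Z X.
Proof. by rewrite ripC ripDr !(ripC X). Qed.

Lemma ripNl m n (X Y : 'M[C]_(m, n)) : rip (- Y) X = - rip Y X.
Proof. by rewrite ripC ripNr (ripC X). Qed.

Lemma ripZl m n a (X Y : 'M[C]_(m, n)) : rip (a%:C *: Y) X = a * rip Y X.
Proof. by rewrite ripC ripZr ripC. Qed.

Lemma rip_iC m n (X Y : 'M[C]_(m, n)) : rip X (iC R *: Y) = - rip (iC R *: X) Y.
Proof.
rewrite /rip dagZ -scalemxAr -scalemxAl !mxtraceZ conj_iC mulNr ReN.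
by rewrite opprK.
Qed.

Lemma rip_mull m n p (A : 'M[C]_(m, n)) (X : 'M[C]_(n, p)) (Y : 'M[C]_(m, p)) :
  rip (A *m X) Y = rip X (dag A *m Y).
Proof. by rewrite /rip dagM mulmxA. Qed.

Lemma rip_tr m n (A : 'M[C]_m) (Y : 'M[C]_(m, n)) :
  Re (\tr (A *m (Y *m dag Y))) = rip Y (A *m Y).
Proof. by rewrite /rip mulmxA mxtrace_mulC. Qed.

Lemma frob_ge0 m n (X : 'M[C]_(m, n)) : 0 <= frob X.
Proof. exact: sqrtr_ge0. Qed.

Lemma sqr_frob m n (X : 'M[C]_(m, n)) : frob X ^+ 2 = rip X X.
Proof.
rewrite sqr_sqrtr ?ripE.
  by do 2![apply: eq_bigr => ? _]; rewrite !expr2.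
by do 2![apply: sumr_ge0 => ? _]; rewrite addr_ge0 ?sqr_ge0.
Qed.

Lemma rip_ge0 m n (X : 'M[C]_(m, n)) : 0 <= rip X X.
Proof. by rewrite -sqr_frob sqr_ge0. Qed.

Lemma frob_le m n (X : 'M[C]_(m, n)) (a : R) : 0 <= a -> rip X X <= a ^+ 2 ->
  frob X <= a.
Proof. by move=> a0; rewrite -sqr_frob ler_pXn2r // nnegrE frob_ge0. Qed.

Lemma frob_eq0 m n (X : 'M[C]_(m, n)) : frob X = 0 -> X = 0.
Proof.
move=> /(congr1 (fun x => x ^+ 2)); rewrite sqr_frob expr0n /= ripE => /eqP.
rewrite psumr_eq0; last first.
  by move=> i _; apply: sumr_ge0 => j _; rewrite -!expr2 addr_ge0 ?sqr_ge0.
move=> /allP h; apply/matrixP => i j; rewrite mxE.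
have /implyP := h i (mem_index_enum _) => /(_ isT).
rewrite psumr_eq0; last by move=> k _; rewrite -!expr2 addr_ge0 ?sqr_ge0.
move=> /allP /(_ j (mem_index_enum _)) /implyP /(_ isT).
rewrite -!expr2 paddr_eq0 ?sqr_ge0 // !sqrf_eq0 => /andP[/eqP a /eqP b].
exact: complex_ext.
Qed.

Lemma rip_frob0 m n (X Y : 'M[C]_(m, n)) : frob X = 0 -> rip X Y = 0.
Proof.
by move/frob_eq0 ->; rewrite -[0](scale0r 0) -[0 : C]/((0 : R)%:C) ripZl mul0r.
Qed.

Lemma rip_le_frob m n (X Y : 'M[C]_(m, n)) : rip X Y <= frob X * frob Y.
Proof.
have [X0|X0] := eqVneq (frob X) 0; first by rewrite rip_frob0 // X0 mul0r.
have [Y0|Y0] := eqVneq (frob Y) 0; first by rewrite ripC rip_frob0 // Y0 mulr0.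
have Xp : 0 < frob X by rewrite lt_neqAle eq_sym X0 frob_ge0.
have Yp : 0 < frob Y by rewrite lt_neqAle eq_sym Y0 frob_ge0.
(* Rescaled to equal length, the difference has squared norm 2|X||Y|(|X||Y| - <X, Y>). *)
have := rip_ge0 ((frob Y)%:C *: X - (frob X)%:C *: Y).
rewrite !(ripDl, ripDr, ripNl, ripNr, ripZl, ripZr) -!sqr_frob (ripC Y X) => h.
rewrite -(ler_pM2l (mulr_gt0 Xp Yp)); nra.
Qed.

Lemma norm_rip_le_frob m n (X Y : 'M[C]_(m, n)) : `|rip X Y| <= frob X * frob Y.
Proof.
rewrite ler_norml rip_le_frob andbT lerNl -ripNl.
apply: le_trans (rip_le_frob _ _) _.
suff -> : frob (- X) = frob X by [].
by apply/eqP; rewrite -(@eqrXn2 _ 2) ?frob_ge0 // !sqr_frob ripNl ripNr opprK.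
Qed.

Lemma frob_eq m n p q (X : 'M[C]_(m, n)) (Y : 'M[C]_(p, q)) :
  rip X X = rip Y Y -> frob X = frob Y.
Proof. by move=> h; apply/eqP; rewrite -(@eqrXn2 _ 2) ?frob_ge0 // !sqr_frob h. Qed.

Lemma frobN m n (X : 'M[C]_(m, n)) : frob (- X) = frob X.
Proof. by apply: frob_eq; rewrite ripNl ripNr opprK. Qed.

Lemma frobD m n (X Y : 'M[C]_(m, n)) : frob (X + Y) <= frob X + frob Y.
Proof.
apply: frob_le; first by rewrite addr_ge0 ?frob_ge0.
rewrite !(ripDl, ripDr) (ripC Y X) -!sqr_frob.
by have := rip_le_frob X Y; nra.
Qed.

Lemma frob_iC m n (X : 'M[C]_(m, n)) : frob (iC R *: X) = frob X.
Proof.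
apply: frob_eq; rewrite rip_iC scalerA iC_mul_iC scaleN1r ripNl.
exact: opprK.
Qed.

Lemma frob_dag m n (X : 'M[C]_(m, n)) : frob (dag X) = frob X.
Proof. by apply: frob_eq; rewrite /rip dagK mxtrace_mulC. Qed.

(** Complex Cauchy-Schwarz in real coordinates; there is no conjugation because the sum is meant to
    be an entry of a matrix product. *)
Lemma sum_CauchySchwarz (n : nat) (a b c d : 'I_n -> R) :
  (\sum_k (a k * c k - b k * d k)) ^+ 2 +
  (\sum_k (a k * d k + b k * c k)) ^+ 2 <=
  (\sum_k (a k ^+ 2 + b k ^+ 2)) * (\sum_k (c k ^+ 2 + d k ^+ 2)).
Proof.
elim: n a b c d => [|n IH] a b c d.
  by rewrite !big_ord0; lra.
rewrite !big_ord_recl.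
have := IH (fun i => a (lift ord0 i)) (fun i => b (lift ord0 i))
           (fun i => c (lift ord0 i)) (fun i => d (lift ord0 i)).
have A0 : 0 <= \sum_(i < n) (a (lift ord0 i) ^+ 2 + b (lift ord0 i) ^+ 2).
  by apply: sumr_ge0 => i _; rewrite addr_ge0 ?sqr_ge0.
have B0 : 0 <= \sum_(i < n) (c (lift ord0 i) ^+ 2 + d (lift ord0 i) ^+ 2).
  by apply: sumr_ge0 => i _; rewrite addr_ge0 ?sqr_ge0.
move: A0 B0.
set A := \sum_(i < n) _; set B := \sum_(i < n) _; set S := \sum_(i < n) _;
set T := \sum_(i < n) _ => A0 B0 h.
set a0 := a ord0; set b0 := b ord0; set c0 := c ord0; set d0 := d ord0.
set u := a0 * c0 - b0 * d0; set v := a0 * d0 + b0 * c0.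
set p := a0 ^+ 2 + b0 ^+ 2; set q := c0 ^+ 2 + d0 ^+ 2.
have uv : u ^+ 2 + v ^+ 2 = p * q by rewrite /u /v /p /q; ring.
have p0 : 0 <= p by rewrite addr_ge0 ?sqr_ge0.
have q0 : 0 <= q by rewrite addr_ge0 ?sqr_ge0.
clearbody u v p q A B S T.
have st : (u * S + v * T) ^+ 2 <= (p * q) * (A * B).
  have : (u * S + v * T) ^+ 2 <= (u ^+ 2 + v ^+ 2) * (S ^+ 2 + T ^+ 2).
    by rewrite -subr_ge0; have := sqr_ge0 (u * T - v * S); nra.
  move/le_trans; apply; rewrite uv ler_wpM2l // mulr_ge0 //.
(* The cross term of the induction: by [st] its square is at most 4(pB)(qA), hence at most (pB +
   qA)^2. *)
have : 2 * (u * S + v * T) <= p * B + q * A.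
  rewrite leNgt; apply/negP => lt.
  have g0 : 0 <= p * B + q * A by rewrite addr_ge0 // mulr_ge0.
  have := sqr_ge0 (p * B - q * A).
  have : (p * B + q * A) ^+ 2 < (2 * (u * S + v * T)) ^+ 2.
    by rewrite ltr_pXn2r // nnegrE ?(ltW (le_lt_trans g0 lt)).
  nra.
by nra.
Qed.

Lemma frobM m n p (A : 'M[C]_(m, n)) (X : 'M[C]_(n, p)) :
  frob (A *m X) <= frob A * frob X.
Proof.
apply: frob_le; first by rewrite mulr_ge0 ?frob_ge0.
rewrite exprMn !sqr_frob !ripE mulr_suml; apply: ler_sum => i _.
rewrite exchange_big [X in _ <= _ * X]/= mulr_sumr; apply: ler_sum => k _.
have -> : Re ((A *m X) i k) =
    \sum_j (Re (A i j) * Re (X j k) - Im (A i j) * Im (X j k)).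
  by rewrite mxE Re_sum; apply: eq_bigr => j _; rewrite ReM.
have -> : Im ((A *m X) i k) =
    \sum_j (Re (A i j) * Im (X j k) + Im (A i j) * Re (X j k)).
  by rewrite mxE Im_sum; apply: eq_bigr => j _; rewrite ImM.
rewrite -!expr2; apply: le_trans (sum_CauchySchwarz _ _ _ _) _.
by rewrite le_eqVlt; apply/orP; left.
Qed.

(* The amplification A (x) 1 is bounded by the Frobenius norm of A alone,
   whereas frob (A *t 1%:M) grows with the dimension of the second factor. *)
Lemma frob_tens1M m n p (A : 'M[C]_m) (X : 'M[C]_(m * n, p)) :
  frob ((A *t (1%:M : 'M[C]_n)) *m X) <= frob A * frob X.
Proof.
pose S (k : 'I_n) : 'M[C]_(m, p) := \matrix_(i, j) X (mxtens_index (i, k)) j.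
have XS : rip X X = \sum_k rip (S k) (S k).
  rewrite ripE mxtens_sum exchange_big; apply: eq_bigr => k _.
  rewrite ripE; apply: eq_bigr => i _; apply: eq_bigr => j _.
  by rewrite !mxE.
have AXS : rip ((A *t (1%:M : 'M[C]_n)) *m X) ((A *t (1%:M : 'M[C]_n)) *m X)
    = \sum_k rip (A *m S k) (A *m S k).
  rewrite ripE mxtens_sum exchange_big; apply: eq_bigr => k _.
  rewrite ripE; apply: eq_bigr => i _; apply: eq_bigr => j _.
  suff -> : ((A *t (1%:M : 'M[C]_n)) *m X) (mxtens_index (i, k)) j
    = (A *m S k) i j by [].
  rewrite !mxE mxtens_sum; apply: eq_bigr => i' _.
  rewrite (bigD1 k) //= big1 ?addr0; last first.
    by move=> k' /negPf nk; rewrite tensmxE !mxE eq_sym nk mulr0 mul0r.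
  by rewrite tensmxE !mxE eqxx mulr1.
apply: frob_le; first by rewrite mulr_ge0 ?frob_ge0.
rewrite AXS exprMn [frob X ^+ 2]sqr_frob XS mulr_sumr; apply: ler_sum => k _.
by rewrite -!sqr_frob -exprMn ler_pXn2r ?frobM // nnegrE ?mulr_ge0 ?frob_ge0.
Qed.

End LinearAlgebra.

(** * Positive matrices, projections and purifications *)

Section PositiveMatrices.
Variable R : realType.
Local Notation C := R[i].
Local Notation Re := (@complex.Re R).
Local Notation Im := (@complex.Im R).

(* Nonnegativity in factored form: a factor of a state is a purification of it, and
   a factor of H turns the energy form <X, H Y> into a genuine inner product. *)
Definition gram n (X : 'M[C]_n) : Prop :=
  exists (m : nat) (Y : 'M[C]_(n, m)), X = Y *m dag Y.

Lemma gram_congr m n (B : 'M[C]_(m, n)) (X : 'M[C]_n) :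
  gram X -> gram (B *m X *m dag B).
Proof. by move=> [p [Y ->]]; exists p, (B *m Y); rewrite dagM !mulmxA. Qed.

Lemma gramD n (X Y : 'M[C]_n) : gram X -> gram Y -> gram (X + Y).
Proof.
move=> [p [A ->]] [q [B ->]]; exists (p + q)%N, (row_mx A B).
by rewrite /dag map_row_mx tr_row_mx mul_row_col.
Qed.

Lemma gram0 n : gram (0 : 'M[C]_n).
Proof. by exists 0%N, 0; rewrite mul0mx. Qed.

Lemma gram_sum n (I : Type) (r : seq I) (F : I -> 'M[C]_n) :
  (forall i, gram (F i)) -> gram (\sum_(i <- r) F i).
Proof.
by move=> h; apply: big_ind => [|X Y|i _]; [exact: gram0|exact: gramD|exact: h].
Qed.

Lemma gramZ n (a : R) (X : 'M[C]_n) : 0 <= a -> gram X -> gram (a%:C *: X).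
Proof.
move=> a0 [p [Y ->]]; exists p, ((Num.sqrt a)%:C *: Y).
rewrite dagZ conj_real -scalemxAl -scalemxAr scalerA -rmorphM -expr2.
by rewrite sqr_sqrtr.
Qed.

Lemma gram_tens m n (X : 'M[C]_m) (Y : 'M[C]_n) :
  gram X -> gram Y -> gram (X *t Y).
Proof.
move=> [p [A ->]] [q [B ->]]; exists (p * q)%N, (A *t B).
by rewrite dag_tens tensmx_mul.
Qed.

Lemma tr_gram m n (Y : 'M[C]_(m, n)) : \tr (Y *m dag Y) = (frob Y ^+ 2)%:C.
Proof.
rewrite sqr_frob /rip [\tr (dag Y *m Y)]mxtrace_mulC; apply: complex_ext => //.
rewrite ImC /mxtrace Im_sum big1 // => i _; rewrite mxE Im_sum big1 // => j _.
by rewrite dagE ImM ReJ ImJ; ring.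
Qed.

Lemma gram_tr n (X : 'M[C]_n) : gram X ->
  0 <= Re (\tr X) /\ \tr X = (Re (\tr X))%:C.
Proof. by move=> [m [Y ->]]; rewrite tr_gram ReC sqr_ge0. Qed.

Lemma gram_tr0 n (X : 'M[C]_n) : gram X -> \tr X = 0 -> X = 0.
Proof.
move=> [m [Y ->]]; rewrite tr_gram => -[/eqP].
by rewrite sqrf_eq0 => /eqP /frob_eq0 ->; rewrite mul0mx.
Qed.

Lemma gram_mul_tr_ge0 n (H X : 'M[C]_n) : gram H -> gram X ->
  0 <= Re (\tr (H *m X)).
Proof.
move=> [p [W ->]] [q [Y ->]]; rewrite rip_tr -mulmxA -{1}[W]dagK -rip_mull.
exact: rip_ge0.
Qed.

(** Spectral theorem: with [A] = P^dag D P, the factor is P^dag D^(1/2). Eigenvectors are row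
    vectors, so the rows of P witness that the entries of D are eigenvalues. *)
Lemma herm_eigenvalue_ge0_gram n (A : 'M[C]_n) :
  herm A -> (forall a, eigenvalue A a -> 0 <= a) -> gram A.
Proof.
move=> hA eA.
have nA : A \is normalmx.
  apply/normalmxP; have -> // : map_mx Num.conj A^T = A.
  by rewrite -map_trmx; exact: hA.
have /orthomx_spectralP Aeq := nA.
have Pu := spectral_unitarymx A.
set P := spectralmx A in Aeq Pu *; set d := spectral_diag A in Aeq *.
have PV : invmx P = dag P by rewrite invmx_unitary // -map_trmx.
have Punit : P \in unitmx by exact: unitarymx_unit.
have d0 i : 0 <= d 0 i.
  apply: eA; apply/eigenvalueP; exists (row i P).
    rewrite -row_mul Aeq !mulmxA mulmxV // mul1mx row_mul.
    by rewrite row_diag_mx -scalemxAl -rowE.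
  apply/eqP => /(congr1 (fun v => v *m invmx P)).
  rewrite mul0mx -row_mul mulmxV // => /rowP /(_ i).
  by rewrite !mxE eqxx => /eqP; rewrite oner_eq0.
exists n, (dag P *m diag_mx (\row_i sqrtC (d 0 i))).
rewrite dagM dagK Aeq PV !mulmxA; congr (_ *m _).
rewrite -mulmxA; congr (_ *m _); apply/matrixP => i j.
rewrite mul_diag_mx !mxE; case: (eqVneq i j) => [<-|ij].
  rewrite ?eqxx !mulr1n geC0_conj ?sqrtC_ge0 //.
  by rewrite -expr2 sqrtCK.
by rewrite ?[j == i]eq_sym ?(negPf ij) !mulr0n rmorph0 mulr0.
Qed.

Lemma psd_gram n (A : 'M[C]_n) : psd_mx A -> gram A.
Proof.
move=> [hA qA]; apply: herm_eigenvalue_ge0_gram => // a /eigenvalueP[v va v0].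
have := qA (dag v); rewrite dagK va -scalemxAl mxE.
have vv : 0 < (v *m dag v) 0 0.
  have -> : (v *m dag v) 0 0 = (frob v ^+ 2)%:C.
    by rewrite -tr_gram /mxtrace big_ord1.
  rewrite ltcR exprn_gt0 // lt_neqAle frob_ge0 andbT eq_sym.
  by apply: contra v0 => /eqP /frob_eq0 ->.
by rewrite pmulr_lge0.
Qed.

(** The [s i] are eigenvalues of A^dag A, hence nonnegative, and the square of the sum of their
    roots dominates their sum, which is tr(A^dag A). *)
Lemma is_trnorm_ge_frob n (A : 'M[C]_n) (r : R) : is_trnorm A r -> frob A <= r.
Proof.
case: n A => [|n] A [s [sE rE]].
  suff -> : frob A = 0 by rewrite -lecR rE big_ord0.
  by rewrite /frob big_ord0 sqrtr0.
have s0 i : 0 <= s i.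
  have : eigenvalue (dag A *m A) (s i).
    rewrite eigenvalue_root_char sE /root horner_prod (bigD1 i) //=.
    by rewrite hornerXsubC subrr mul0r.
  move=> /eigenvalueP[v vE v0].
  have vv : 0 < \tr (v *m dag v).
    rewrite tr_gram ltcR exprn_gt0 // lt_neqAle frob_ge0 andbT eq_sym.
    by apply: contra v0 => /eqP /frob_eq0 ->.
  have : 0 <= \tr ((v *m dag A) *m dag (v *m dag A)).
    by rewrite tr_gram ler0c sqr_ge0.
  rewrite dagM dagK mulmxA -[v *m dag A *m A]mulmxA vE -scalemxAl mxtraceZ.
  by rewrite pmulr_lge0.
(* Compares subleading coefficients of the characteristic polynomial, which requires positive
   dimension; hence the case split on [n]. *)
have trE : \tr (dag A *m A) = \sum_i s i.
  have := char_poly_trace (dag A *m A) (ltn0Sn n).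
  rewrite sE /= => h; apply: oppr_inj; rewrite -h.
  have sz : size [seq s i | i <- index_enum 'I_n.+1] = n.+1.
    by rewrite size_map [index_enum _]unlock -enumT size_enum_ord.
  have := coefPn_prod_XsubC (ps := [seq s i | i <- index_enum 'I_n.+1]).
  by rewrite sz !big_map => /(_ isT).
have r0 : 0 <= r.
  by rewrite -ler0c rE sumr_ge0 // => i _; rewrite sqrtC_ge0.
apply: frob_le => //; rewrite -sqr_frob -frob_dag -lecR -tr_gram dagK.
rewrite trE rmorphXn /= rE expr2 mulr_suml.
apply: ler_sum => i _; rewrite -{1}[s i]sqrtCK expr2 ler_wpM2l ?sqrtC_ge0 //.
rewrite [leRHS](bigD1 i) //= lerDl sumr_ge0 // => j _.
by rewrite sqrtC_ge0.
Qed.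

Lemma ketbra_herm n (v : 'cV[C]_n) : herm (ketbra v).
Proof. by rewrite /herm /ketbra dagM dagK. Qed.

(** The overlap deficit is the inner product of the unit matrix [ketbra v] with the difference, so
    Cauchy-Schwarz and the comparison of trace and Frobenius norms bound it by 2e. The factor 2 is
    affordable for the constants below. *)
Lemma trdist_le_overlap n (rho : 'M[C]_n) (v : 'cV[C]_n) (e : R) :
  (dag v *m v) 0 0 = 1 -> trdist_le rho (ketbra v) e ->
  1 - 2 * e <= Re (\tr (ketbra v *m rho)).
Proof.
move=> v1 [r [/is_trnorm_ge_frob rT re]].
have vv : dag v *m v = 1%:M by rewrite [LHS]mx11_scalar v1.
have GG : ketbra v *m ketbra v = ketbra v.
  by rewrite /ketbra -mulmxA (mulmxA (dag v)) vv mul1mx.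
have fG : frob (ketbra v) = 1.
  apply/eqP; rewrite -(@eqrXn2 _ 2) ?frob_ge0 // sqr_frob /rip.
  rewrite (ketbra_herm v) GG /ketbra mxtrace_mulC /mxtrace big_ord1 v1.
  by rewrite expr1n.
have := norm_rip_le_frob (ketbra v) (rho - ketbra v).
rewrite ler_norml fG mul1r => /andP[h _].
have : rip (ketbra v) (rho - ketbra v) = Re (\tr (ketbra v *m rho)) - 1.
  rewrite ripDr ripNr -[rip _ (ketbra v)]sqr_frob fG expr1n.
  by rewrite /rip (ketbra_herm v).
move=> E; rewrite E in h; lra.
Qed.

Lemma ketbraM n k (e : 'I_k -> 'cV[C]_n) a b : orthonormal_fam e ->
  ketbra (e a) *m ketbra (e b) = (a == b)%:R *: ketbra (e a).
Proof.
move=> oe; rewrite /ketbra -mulmxA (mulmxA (dag _)) [dag _ *m _]mx11_scalar oe.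
rewrite mul_scalar_mx -scalemxAr.
by case: eqVneq => [->|]; rewrite ?scale0r.
Qed.

Lemma sum_ketbraM n k (e : 'I_k -> 'cV[C]_n) (c d : 'I_k -> C) :
  orthonormal_fam e ->
  (\sum_a c a *: ketbra (e a)) *m (\sum_a d a *: ketbra (e a)) =
  \sum_a (c a * d a) *: ketbra (e a).
Proof.
move=> oe; rewrite mulmx_suml; apply: eq_bigr => a _.
rewrite mulmx_sumr (bigD1 a) //= big1 ?addr0.
  by rewrite -scalemxAl -scalemxAr ketbraM // eqxx scale1r scalerA.
move=> b /negPf ba; rewrite -scalemxAl -scalemxAr ketbraM // eq_sym ba.
by rewrite scale0r !scaler0.
Qed.

Lemma sum_ketbra_herm n k (e : 'I_k -> 'cV[C]_n) (c : 'I_k -> R) :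
  herm (\sum_a (c a)%:C *: ketbra (e a)).
Proof.
rewrite /herm dag_sum; apply: eq_bigr => a _.
by rewrite dagZ conj_real ketbra_herm.
Qed.

Lemma herm_tens m n (A : 'M[C]_m) (B : 'M[C]_n) :
  herm A -> herm B -> herm (A *t B).
Proof. by rewrite /herm dag_tens => -> ->. Qed.

Definition is_proj n (P : 'M[C]_n) := herm P /\ P *m P = P.

Lemma proj_compl_rip m n (P : 'M[C]_n) (X : 'M[C]_(n, m)) : is_proj P ->
  rip (X - P *m X) (X - P *m X) = rip X X - rip X (P *m X).
Proof.
move=> [hP PP]; rewrite !(ripDl, ripDr, ripNl, ripNr) !(rip_mull P) hP.
by rewrite mulmxA PP; ring.
Qed.

Lemma proj_rip m n (P : 'M[C]_n) (X : 'M[C]_(n, m)) : is_proj P ->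
  rip (P *m X) (P *m X) = rip X (P *m X).
Proof. by move=> [hP PP]; rewrite rip_mull hP mulmxA PP. Qed.

Lemma frob_proj_le m n (P : 'M[C]_n) (X : 'M[C]_(n, m)) : is_proj P ->
  frob (P *m X) <= frob X.
Proof.
move=> pP; apply: frob_le; rewrite ?frob_ge0 // sqr_frob proj_rip //.
by have := rip_ge0 (X - P *m X); rewrite proj_compl_rip //; lra.
Qed.

Lemma frob_proj_compl_le m n (P : 'M[C]_n) (X : 'M[C]_(n, m)) : is_proj P ->
  frob (X - P *m X) <= frob X.
Proof.
move=> pP; apply: frob_le; rewrite ?frob_ge0 // sqr_frob proj_compl_rip //.
by have := rip_ge0 (P *m X); rewrite proj_rip //; lra.
Qed.

(** The main parts PX and QY are orthogonal, so only the leaked parts contribute. *)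
Lemma rip_le_orthogonal_proj m n (P Q : 'M[C]_n) (X Y : 'M[C]_(n, m)) :
  is_proj P -> is_proj Q -> P *m Q = 0 ->
  rip X Y <= frob (X - P *m X) * frob Y + frob X * frob (Y - Q *m Y).
Proof.
move=> pP pQ PQ.
have -> : rip X Y = rip (X - P *m X) Y + rip (P *m X) (Y - Q *m Y).
  rewrite !(ripDl, ripDr, ripNl, ripNr) (rip_mull P X (Q *m Y)) pP.1 mulmxA PQ.
  by rewrite mul0mx -(scale0r 0) -[0 : C]/((0 : R)%:C) ripZr; ring.
rewrite lerD ?rip_le_frob //; apply: le_trans (rip_le_frob _ _) _.
by rewrite ler_wpM2r ?frob_ge0 // frob_proj_le.
Qed.

Lemma frob_unimodular m n (c : C) (X : 'M[C]_(m, n)) : `|c| = 1 ->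
  frob (c *: X) = frob X.
Proof.
move=> c1; apply: frob_eq; rewrite /rip dagZ -scalemxAl -scalemxAr scalerA.
by rewrite [_ * c]mulrC -normCK c1 expr1n scale1r.
Qed.

(** Reshaping the vector on system and ancilla into a matrix turns the amplified operator into left
    multiplication. *)
Lemma semiclassical_purification n (A B rho : 'M[C]_n) : semiclassical A B rho ->
  exists (d : nat) (Z : 'M[C]_(n, d)) (lam mu : C),
    `|lam| = 1 /\ (lam *: A + iC R *: B) *m Z = mu *: Z /\ rho = Z *m dag Z.
Proof.
move=> [d [psi [lam [mu [_ [lam1 [ev ->]]]]]]].
pose Z : 'M[C]_(n, d) := \matrix_(i, k) psi (mxtens_index (i, k)) 0.
exists d, Z, lam, mu; split => //; split; last first.
  apply/matrixP => i j; rewrite !mxE; apply: eq_bigr => k _.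
  by rewrite !mxE big_ord1 !mxE.
apply/matrixP => i k; move/matrixP: ev => /(_ (mxtens_index (i, k)) 0).
move: (_ + _) => M; rewrite [X in _ = X -> _]mxE => ev.
rewrite [RHS]mxE [Z _ _]mxE -ev !mxE mxtens_sum; apply: eq_bigr => j _.
rewrite (bigD1 k) //= big1 ?addr0; last first.
  by move=> k' /negPf nk; rewrite tensmxE !mxE eq_sym nk mulr0 mul0r.
by rewrite tensmxE !mxE eqxx mulr1.
Qed.

(* For an eigenvector of lam A + i B the spreads of A and B coincide; the shift
   h is the real part of the induced eigenvalue of B. *)
Lemma eigen_spread_le m n (A B : 'M[C]_n) (Z : 'M[C]_(n, m)) (lam mu : C) :
  herm B -> `|lam| = 1 -> (lam *: A + iC R *: B) *m Z = mu *: Z ->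
  exists h : R, frob (B *m Z - h%:C *: Z) <= frob (A *m Z).
Proof.
move=> hB lam1 ev; pose z := - iC R * mu; exists (Re z).
pose D := B *m Z - (Re z)%:C *: Z.
have BZ : B *m Z = z *: Z + iC R *: (lam *: (A *m Z)).
  rewrite -scalerA -ev mulmxDl -!scalemxAl scalerDr !scaleNr !scalerA.
  by rewrite iC_mul_iC scaleN1r opprK [iC R * lam]mulrC addrAC addNr add0r.
have DE : D - (Im z)%:C *: (iC R *: Z) = iC R *: (lam *: (A *m Z)).
  rewrite /D BZ {1}(_ : z = (Re z)%:C + (Im z)%:C * iC R).
    by rewrite scalerDl -scalerA; apply/matrixP => i j; rewrite !mxE; ring.
  by apply: complex_ext; rewrite ?(ReD, ImD, ReM, ImM) /=; ring.
(* Self-adjointness of B - Re z makes <Z, D> real. By Pythagoras in [DE], |A Z|^2 = |D|^2 + (Im z)^2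
   |Z|^2. *)
have orth : rip D (iC R *: Z) = 0.
  have h1 : rip D (iC R *: Z) = rip Z (iC R *: D).
    rewrite /D ripDl ripNl ripZl rip_mull hB -scalemxAr scalerBr ripDr ripNr.
    by rewrite scalerA [iC R * _]mulrC -scalerA ripZr.
  by move: h1; rewrite rip_iC ripC rip_iC; lra.
rewrite -/D -[frob (A *m Z)](frob_unimodular _ lam1) -[frob (lam *: _)]frob_iC.
rewrite -DE; clearbody D.
apply: frob_le; rewrite ?frob_ge0 // sqr_frob.
rewrite !(ripDl, ripDr, ripNl, ripNr) !(ripZl, ripZr) (ripC _ D) orth.
by have := rip_ge0 (iC R *: Z); nra.
Qed.

End PositiveMatrices.

(** * Entrywise calculus and the matrix exponential *)
Section MatrixCalculus.
Variable R : realType.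
Local Notation C := R[i].
Local Notation Re := (@complex.Re R).
Local Notation Im := (@complex.Im R).

Definition cderiv (f : R -> C) (t : R) (d : C) : Prop :=
  is_derive t (1 : R) (fun s => Re (f s)) (Re d) /\
  is_derive t (1 : R) (fun s => Im (f s)) (Im d).

(** Same entrywise form as in [is_flow], so the flow equation is literally an [mderiv]. *)
Definition mderiv m n (F : R -> 'M[C]_(m, n)) (t : R) (D : 'M[C]_(m, n)) : Prop :=
  forall i j, cderiv (fun s => F s i j) t (D i j).

Lemma is_derive_ext (f g : R -> R) (t a b : R) :
  is_derive t 1 f a -> f =1 g -> a = b -> is_derive t 1 g b.
Proof. by move=> h /funext <- <-. Qed.

Lemma is_deriveM_real (f g : R -> R) (t a b : R) :
  is_derive t 1 f a -> is_derive t 1 g b ->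
  is_derive t 1 (fun s => f s * g s) (a * g t + f t * b).
Proof.
move=> hf hg; apply: is_derive_ext (is_deriveM hf hg) _ _ => //.
by rewrite /GRing.scale /=; ring.
Qed.

Lemma cderiv_ext (f g : R -> C) t a b : cderiv f t a -> f =1 g -> a = b ->
  cderiv g t b.
Proof. by move=> h /funext <- <-. Qed.

Lemma cderiv_cst (a : C) t : cderiv (fun=> a) t 0.
Proof. by split; apply: is_derive_cst. Qed.

Lemma cderivD (f g : R -> C) t a b : cderiv f t a -> cderiv g t b ->
  cderiv (fun s => f s + g s) t (a + b).
Proof.
move=> [f1 f2] [g1 g2]; split.
  by apply: is_derive_ext (is_deriveD f1 g1) _ _ => [s|] /=; rewrite ReD.
by apply: is_derive_ext (is_deriveD f2 g2) _ _ => [s|] /=; rewrite ImD.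
Qed.

Lemma cderivM (f g : R -> C) t a b : cderiv f t a -> cderiv g t b ->
  cderiv (fun s => f s * g s) t (a * g t + f t * b).
Proof.
move=> [f1 f2] [g1 g2]; split.
  apply: is_derive_ext (is_deriveD (is_deriveM_real f1 g1)
    (is_deriveN (is_deriveM_real f2 g2))) _ _ => [s|] /=.
    by rewrite ReM.
  by rewrite !(ReD, ReM); ring.
apply: is_derive_ext (is_deriveD (is_deriveM_real f1 g2)
    (is_deriveM_real f2 g1)) _ _ => [s|] /=.
  by rewrite ImM.
by rewrite !(ImD, ImM); ring.
Qed.

Lemma cderiv_sum (I : Type) (r : seq I) (f : I -> R -> C) t (a : I -> C) :
  (forall i, cderiv (f i) t (a i)) ->
  cderiv (fun s => \sum_(i <- r) f i s) t (\sum_(i <- r) a i).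
Proof.
move=> h; elim: r => [|i r IH].
  by apply: cderiv_ext (cderiv_cst 0 t) _ _ => [s|]; rewrite big_nil.
by apply: cderiv_ext (cderivD (h i) IH) _ _ => [s|]; rewrite big_cons.
Qed.

Lemma cderiv_conj (f : R -> C) t a : cderiv f t a ->
  cderiv (fun s => Num.conj (f s)) t (Num.conj a).
Proof.
move=> [f1 f2]; split.
  by apply: is_derive_ext f1 _ _ => [s|]; rewrite ReJ.
by apply: is_derive_ext (is_deriveN f2) _ _ => [s|] /=; rewrite ImJ.
Qed.

Lemma mderiv_ext m n (F G : R -> 'M[C]_(m, n)) t D D' :
  mderiv F t D -> F =1 G -> D = D' -> mderiv G t D'.
Proof. by move=> h /funext <- <-. Qed.

Lemma mderiv_cst m n (A : 'M[C]_(m, n)) t : mderiv (fun=> A) t 0.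
Proof. by move=> i j; rewrite mxE; apply: cderiv_cst. Qed.

Lemma mderivZ m n (f : R -> C) (F : R -> 'M[C]_(m, n)) t d D :
  cderiv f t d -> mderiv F t D ->
  mderiv (fun s => f s *: F s) t (d *: F t + f t *: D).
Proof.
move=> hf hF i j; apply: cderiv_ext (cderivM hf (hF i j)) _ _ => [s|];
by rewrite !mxE.
Qed.

Lemma mderivM m n p (F : R -> 'M[C]_(m, n)) (G : R -> 'M[C]_(n, p)) t D D' :
  mderiv F t D -> mderiv G t D' ->
  mderiv (fun s => F s *m G s) t (D *m G t + F t *m D').
Proof.
move=> hF hG i j.
apply: cderiv_ext (cderiv_sum _ (fun k => cderivM (hF i k) (hG k j))) _ _.
  by move=> s; rewrite mxE.
by rewrite !mxE big_split.
Qed.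

Lemma mderivMl m n p (A : 'M[C]_(m, n)) (G : R -> 'M[C]_(n, p)) t D :
  mderiv G t D -> mderiv (fun s => A *m G s) t (A *m D).
Proof.
move=> hG; apply: mderiv_ext (mderivM (mderiv_cst A t) hG) _ _ => //.
by rewrite mul0mx add0r.
Qed.

Lemma mderivMr m n p (F : R -> 'M[C]_(m, n)) (B : 'M[C]_(n, p)) t D :
  mderiv F t D -> mderiv (fun s => F s *m B) t (D *m B).
Proof.
move=> hF; apply: mderiv_ext (mderivM hF (mderiv_cst B t)) _ _ => //.
by rewrite mulmx0 addr0.
Qed.

Lemma mderiv_dag m n (F : R -> 'M[C]_(m, n)) t D :
  mderiv F t D -> mderiv (fun s => dag (F s)) t (dag D).
Proof.
move=> hF i j; apply: cderiv_ext (cderiv_conj (hF j i)) _ _ => [s|];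
by rewrite dagE.
Qed.

Lemma mderiv_opp_arg m n (F : R -> 'M[C]_(m, n)) t D :
  mderiv F (- t) D -> mderiv (fun s => F (- s)) t (- D).
Proof.
move=> hF i j; have [h1 h2] := hF i j.
have hN : is_derive t (1 : R) (fun s : R => - s) (-1).
  by apply: is_derive_ext (is_deriveN (is_derive_id t (1 : R))) _ _.
split.
  by apply: is_derive_ext (is_derive1_comp h1 hN) _ _ => //; rewrite mxE ReN mulrN1.
by apply: is_derive_ext (is_derive1_comp h2 hN) _ _ => //; rewrite mxE ImN mulrN1.
Qed.

(** Supplies uniqueness: the group law, unitarity and the formula for the flow each come from a
    product with zero derivative. *)
Lemma mderiv0_cst m n (F : R -> 'M[C]_(m, n)) :
  (forall t, mderiv F t 0) -> forall t, F t = F 0.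
Proof.
move=> h t; apply/matrixP => i j; apply: complex_ext.
  apply: (@is_derive_0_is_cst _ (fun s => Re (F s i j))) => s.
  by have [+ _] := h s i j; rewrite mxE.
apply: (@is_derive_0_is_cst _ (fun s => Im (F s i j))) => s.
by have [_] := h s i j; rewrite mxE.
Qed.

Lemma is_derive_Re_tr n (F : R -> 'M[C]_n) t D : mderiv F t D ->
  is_derive t 1 (fun s => Re (\tr (F s))) (Re (\tr D)).
Proof. by move=> h; have [] := cderiv_sum (index_enum 'I_n) (fun i => h i i). Qed.

Lemma is_derive_rip m n (X : 'M[C]_(m, n)) (F : R -> 'M[C]_(m, n)) t D :
  mderiv F t D -> is_derive t 1 (fun s => rip X (F s)) (rip X D).
Proof. by move=> h; apply: is_derive_Re_tr; apply: mderivMl. Qed.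

(** * Exponential generating series and the matrix exponential *)

Definition expseries (r : nat -> R) (x : R) : R :=
  limn (pseries (fun n => r n / n`!%:R) x).

(** Geometric growth makes [expseries] converge everywhere, and it survives the index shift to which
    differentiation amounts. *)
Definition exp_bounded (r : nat -> R) : Prop :=
  exists K M : R, [/\ 0 <= K, 0 <= M & forall n, `|r n| <= K * M ^+ n].

Lemma exp_bounded_shift r : exp_bounded r -> exp_bounded (fun n => r n.+1).
Proof.
move=> [K [M [K0 M0 h]]]; exists (K * M), M; split => //.
  by rewrite mulr_ge0.
by move=> n; rewrite -mulrA -exprS.
Qed.

Lemma is_cvg_expseries r x : exp_bounded r ->
  cvgn (pseries (fun n => r n / n`!%:R) x).
Proof.
move=> [K [M [K0 M0 h]]]; apply: normed_cvg; rewrite /normed_series_of /=.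
apply: (@series_le_cvg _ _ (fun n => K * exp_coeff (M * `|x|) n)).
- by move=> n; rewrite normr_ge0.
- by move=> n; rewrite mulr_ge0 // /exp_coeff /= divr_ge0 ?exprn_ge0 ?mulr_ge0.
- move=> n; rewrite -[exp_coeff _ n]/((M * `|x|) ^+ n / n`!%:R).
  rewrite !normrM normrX normfV exprMn.
  rewrite [`|n`!%:R|]ger0_norm //.
  rewrite [leRHS](_ : _ = K * M ^+ n / n`!%:R * `|x| ^+ n); last by ring.
  by rewrite ler_wpM2r ?exprn_ge0 // ler_wpM2r ?invr_ge0.
- by apply: is_cvg_seriesZ; apply: is_cvg_series_exp_coeff.
Qed.

Lemma is_derive_expseries r x : exp_bounded r ->
  is_derive x (1 : R) (expseries r) (expseries (fun n => r n.+1) x).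
Proof.
move=> hr; have hr1 := exp_bounded_shift hr; have hr2 := exp_bounded_shift hr1.
have dE (q : nat -> R) : pseries_diffs (fun n => q n / n`!%:R)
    = (fun n => q n.+1 / n`!%:R).
  apply/funext => n; rewrite /pseries_diffs factS natrM invfM.
  by rewrite mulrCA mulVKf ?pnatr_eq0.
(* Any radius beyond |x| serves, since the series and its first two derived series converge
   everywhere. *)
rewrite /expseries -dE; apply: (@pseries_snd_diffs _ _ (`|x| + 1)).
- exact: is_cvg_expseries.
- by rewrite dE; apply: is_cvg_expseries.
- by rewrite !dE; apply: is_cvg_expseries.
- by rewrite [ltRHS]ger0_norm ?addr_ge0 // ltrDl.
Qed.

Lemma exp_boundedZ a r : exp_bounded r -> exp_bounded (fun n => a * r n).
Proof.
move=> [K [M [K0 M0 h]]]; exists (`|a| * K), M; split => //.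
  by rewrite mulr_ge0.
by move=> n; rewrite normrM -mulrA ler_wpM2l.
Qed.

Lemma exp_boundedD r q : exp_bounded r -> exp_bounded q ->
  exp_bounded (fun n => r n + q n).
Proof.
move=> [K [M [K0 M0 h]]] [K' [M' [K'0 M'0 h']]].
exists (K + K'), (Num.max M M'); split; [by rewrite addr_ge0|by rewrite le_max M0|].
move=> n; apply: le_trans (ler_normD _ _) _; rewrite mulrDl; apply: lerD.
  apply: le_trans (h n) _; rewrite ler_wpM2l // lerXn2r // ?nnegrE ?le_max ?M0 //.
  by rewrite lexx.
apply: le_trans (h' n) _; rewrite ler_wpM2l // lerXn2r // ?nnegrE ?le_max ?M0 //.
by rewrite lexx orbT.
Qed.

Lemma expseriesZ a r x : exp_bounded r ->
  expseries (fun n => a * r n) x = a * expseries r x.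
Proof.
move=> hr; rewrite /expseries -[RHS]lim_seriesZ; last exact: is_cvg_expseries.
congr (limn (series _)); apply/funext => n.
by transitivity (a * (r n / n`!%:R * x ^+ n)) => //=; rewrite !mulrA.
Qed.

Lemma expseriesD r q x : exp_bounded r -> exp_bounded q ->
  expseries (fun n => r n + q n) x = expseries r x + expseries q x.
Proof.
move=> hr hq; rewrite /expseries -lim_seriesD; try exact: is_cvg_expseries.
congr (limn (series _)); apply/funext => n.
by rewrite /= mulrDl mulrDl.
Qed.

Lemma exp_bounded0 : exp_bounded (fun=> 0).
Proof. by exists 0, 0; split => // n; rewrite normr0 mul0r. Qed.

Lemma expseries0 x : expseries (fun=> 0) x = 0.
Proof.
rewrite -[RHS](mul0r (expseries (fun=> 0) x)) -expseriesZ; last exact: exp_bounded0.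
by congr expseries; apply/funext => n; rewrite mul0r.
Qed.

Lemma expseries_sum (I : Type) (s : seq I) (r : I -> nat -> R) x :
  (forall i, exp_bounded (r i)) ->
  exp_bounded (fun n => \sum_(i <- s) r i n) /\
  expseries (fun n => \sum_(i <- s) r i n) x = \sum_(i <- s) expseries (r i) x.
Proof.
move=> hr; elim: s => [|i s [IH1 IH2]].
  under eq_fun do rewrite big_nil.
  by rewrite big_nil expseries0; split => //; exact: exp_bounded0.
under eq_fun do rewrite big_cons.
by rewrite big_cons expseriesD // IH2; split => //; apply: exp_boundedD.
Qed.

Lemma expseries_at0 r : exp_bounded r -> expseries r 0 = r 0%N.
Proof.
move=> hr; rewrite /expseries; apply/cvg_lim => //.
(* The empty partial sum is 0; from index 1 on the partial sums equal [r 0]. *)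
rewrite -(cvg_shiftS _ (nbhs (r 0%N))) /=.
apply: cvg_near_cst; apply: nearW => n.
rewrite /pseries /series /= big_nat_recl // big1 ?addr0 => [|i _].
  by rewrite expr0 fact0 divr1 mulr1.
by rewrite expr0n mulr0.
Qed.

Definition mpow n (A : 'M[C]_n) k : 'M[C]_n := iter k (mulmx A) 1%:M.

Lemma mpowSr n (A : 'M[C]_n) k : mpow A k.+1 = mpow A k *m A.
Proof.
elim: k => [|k IH]; first by rewrite /mpow /= mulmx1 mul1mx.
by transitivity (A *m mpow A k.+1) => //; rewrite [in LHS]IH mulmxA.
Qed.

(** Split into real series so that the real power series calculus applies to each entry. *)
Definition mexp n (A : 'M[C]_n) (t : R) : 'M[C]_n :=
  \matrix_(i, j) (expseries (fun k => Re (mpow A k i j)) t +i*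
                  expseries (fun k => Im (mpow A k i j)) t).

Lemma norm_Re_Im_le_frob m n (X : 'M[C]_(m, n)) i j :
  `|Re (X i j)| <= frob X /\ `|Im (X i j)| <= frob X.
Proof.
suff h : Re (X i j) ^+ 2 + Im (X i j) ^+ 2 <= frob X ^+ 2.
  by split; rewrite -(@ler_pXn2r _ 2) ?nnegrE ?frob_ge0 // ?real_normK ?num_real //;
    apply: le_trans h; rewrite ?lerDl ?lerDr sqr_ge0.
rewrite sqr_frob ripE (bigD1 i) //= (bigD1 j) //= -!expr2 -addrA lerDl addr_ge0 //.
  by apply: sumr_ge0 => k _; rewrite -!expr2 addr_ge0 ?sqr_ge0.
by do 2![apply: sumr_ge0 => ? _]; rewrite -!expr2 addr_ge0 ?sqr_ge0.
Qed.

Lemma mpow_bounded n (A : 'M[C]_n) i j :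
  exp_bounded (fun k => Re (mpow A k i j)) /\
  exp_bounded (fun k => Im (mpow A k i j)).
Proof.
have h k : frob (mpow A k) <= frob (1%:M : 'M[C]_n) * frob A ^+ k.
  elim: k => [|k IH]; first by rewrite expr0 mulr1.
  apply: le_trans (frobM _ _) _; rewrite exprS mulrCA ler_wpM2l ?frob_ge0 //.
by split; exists (frob (1%:M : 'M[C]_n)), (frob A); split;
  rewrite ?frob_ge0 // => k; have [h1 h2] := norm_Re_Im_le_frob (mpow A k) i j;
  apply: le_trans (h k).
Qed.

Lemma mexp0 n (A : 'M[C]_n) : mexp A 0 = 1%:M.
Proof.
apply/matrixP => i j; have [h1 h2] := mpow_bounded A i j.
by rewrite mxE !expseries_at0 // /mpow /=; apply: complex_ext.
Qed.

Lemma expseries_mul (p : nat -> C) (a : C) x :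
  exp_bounded (fun k => Re (p k)) -> exp_bounded (fun k => Im (p k)) ->
  [/\ exp_bounded (fun k => Re (a * p k)), exp_bounded (fun k => Im (a * p k)),
   expseries (fun k => Re (a * p k)) x = Re a * expseries (fun k => Re (p k)) x
     - Im a * expseries (fun k => Im (p k)) x &
   expseries (fun k => Im (a * p k)) x = Re a * expseries (fun k => Im (p k)) x
     + Im a * expseries (fun k => Re (p k)) x].
Proof.
move=> h1 h2.
have -> : (fun k => Re (a * p k)) = (fun k => Re a * Re (p k) + (- Im a) * Im (p k)).
  by apply/funext => k; rewrite ReM mulNr.
have -> : (fun k => Im (a * p k)) = (fun k => Re a * Im (p k) + Im a * Re (p k)).
  by apply/funext => k; rewrite ImM.
by rewrite !expseriesD ?expseriesZ ?mulNr //; try exact: exp_boundedZ;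
  split => //; apply: exp_boundedD; exact: exp_boundedZ.
Qed.

(** The index maps cover both recursions for the powers, A A^k and A^k A; comparing the two yields
    [mexpC]. *)
Lemma mexp_shift n (A : 'M[C]_n) t (c : 'I_n -> 'I_n -> C) (i' j' : 'I_n -> 'I_n) i j :
  (forall k, mpow A k.+1 i j = \sum_l c i l * mpow A k (i' l) (j' l)) ->
  expseries (fun k => Re (mpow A k.+1 i j)) t +i*
  expseries (fun k => Im (mpow A k.+1 i j)) t =
  \sum_l c i l * mexp A t (i' l) (j' l).
Proof.
move=> h.
have H l := expseries_mul (c i l) t (mpow_bounded A (i' l) (j' l)).1
   (mpow_bounded A (i' l) (j' l)).2.
have H1 l : exp_bounded (fun k => Re (c i l * mpow A k (i' l) (j' l))).
  by have [] := H l.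
have H2 l : exp_bounded (fun k => Im (c i l * mpow A k (i' l) (j' l))).
  by have [] := H l.
apply: complex_ext; rewrite /= ?Re_sum ?Im_sum.
  under eq_fun do rewrite h Re_sum.
  have [_ ->] := expseries_sum (index_enum 'I_n) t H1.
  by apply: eq_bigr => l _; have [_ _ -> _] := H l; rewrite ReM mxE.
under eq_fun do rewrite h Im_sum.
have [_ ->] := expseries_sum (index_enum 'I_n) t H2.
by apply: eq_bigr => l _; have [_ _ _ ->] := H l; rewrite ImM mxE.
Qed.

Lemma mderiv_mexp n (A : 'M[C]_n) t : mderiv (mexp A) t (A *m mexp A t).
Proof.
move=> i j; have [h1 h2] := mpow_bounded A i j.
have -> : (A *m mexp A t) i j = expseries (fun k => Re (mpow A k.+1 i j)) t +i*
    expseries (fun k => Im (mpow A k.+1 i j)) t.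
  by rewrite (@mexp_shift _ A t A id (fun=> j)) => [|k]; rewrite [LHS]mxE.
split; rewrite /=.
  by apply: is_derive_ext (is_derive_expseries t h1) _ _ => // s; rewrite mxE.
by apply: is_derive_ext (is_derive_expseries t h2) _ _ => // s; rewrite mxE.
Qed.

Lemma mexpC n (A : 'M[C]_n) t : A *m mexp A t = mexp A t *m A.
Proof.
apply/matrixP => i j; rewrite [LHS]mxE [RHS]mxE.
rewrite -(@mexp_shift _ A t A id (fun=> j) i j) => [|k]; last by rewrite [LHS]mxE.
rewrite (@mexp_shift _ A t (fun _ l => A l j) (fun=> i) id i j) => [|k].
  by apply: eq_bigr => l _; rewrite mulrC.
by rewrite mpowSr mxE; apply: eq_bigr => l _; rewrite mulrC.
Qed.

Lemma mexpNK n (A : 'M[C]_n) t : mexp A (- t) *m mexp A t = 1%:M.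
Proof.
have -> : mexp A (- t) *m mexp A t = mexp A (- 0) *m mexp A 0.
  apply: (mderiv0_cst (F := fun s => mexp A (- s) *m mexp A s)) => s.
  apply: mderiv_ext (mderivM (mderiv_opp_arg (mderiv_mexp A (- s)))
    (mderiv_mexp A s)) _ _ => //.
  by rewrite mulNmx mexpC -mulmxA addNr.
by rewrite oppr0 mexp0 mulmx1.
Qed.

Lemma mexpKN n (A : 'M[C]_n) t : mexp A t *m mexp A (- t) = 1%:M.
Proof. by rewrite -{1}[t]opprK mexpNK. Qed.

(* Variation of constants: conjugating the flow back by the exponential makes it
   constant in time. *)
Lemma flow_mexp n (G : 'M[C]_n) (L : 'M[C]_n -> 'M[C]_n) E :
  (forall X, L X = G *m X + X *m dag G) -> is_flow L E ->
  forall t X, E t X = mexp G t *m X *m dag (mexp G t).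
Proof.
move=> LE hE t X; have [E0 hD] := hE X.
pose F s := mexp G (- s) *m E s X *m dag (mexp G (- s)).
have hF s : mderiv F s 0.
  have hK := mderiv_opp_arg (mderiv_mexp G (- s)).
  have hX : mderiv (fun r => E r X) s (L (E s X)) by exact: hD.
  apply: mderiv_ext (mderivM (mderivM hK hX) (mderiv_dag hK)) _ _ => //.
  rewrite LE dagN dagM mexpC; set K := mexp G (- s); set Y := E s X.
  rewrite !(mulmxDl, mulmxDr, mulNmx, mulmxN) !mulmxA.
  have -> : K *m Y *m dag K *m dag G = K *m Y *m dag G *m dag K.
    by rewrite -!(mulmxA (K *m Y)) -!dagM mexpC.
  by rewrite addrA addNr add0r subrr.
have FX : F t = X by rewrite (mderiv0_cst hF) /F oppr0 mexp0 E0 dag1 mul1mx mulmx1.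
rewrite -[in RHS]FX /F !mulmxA mexpKN mul1mx -mulmxA -dagM mexpKN.
by rewrite dag1 mulmx1.
Qed.

Lemma dag_mexp_unitary n (A : 'M[C]_n) t : dag A = - A ->
  dag (mexp A t) *m mexp A t = 1%:M.
Proof.
move=> hA.
have -> : dag (mexp A t) *m mexp A t = dag (mexp A 0) *m mexp A 0.
  apply: (mderiv0_cst (F := fun s => dag (mexp A s) *m mexp A s)) => s.
  apply: mderiv_ext (mderivM (mderiv_dag (mderiv_mexp A s))
    (mderiv_mexp A s)) _ _ => //.
  by rewrite dagM hA mulmxN mulNmx mulmxA addNr.
by rewrite mexp0 dag1 mulmx1.
Qed.

Lemma frob_mexp n m (A : 'M[C]_n) (X : 'M[C]_(n, m)) t : dag A = - A ->
  frob (mexp A t *m X) = frob X.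
Proof.
by move=> hA; apply: frob_eq; rewrite rip_mull mulmxA dag_mexp_unitary // mul1mx.
Qed.

Lemma frob_mexp_opp n m (A : 'M[C]_n) (X Y : 'M[C]_(n, m)) t : dag A = - A ->
  frob (mexp A (- t) *m X - Y) = frob (X - mexp A t *m Y).
Proof.
move=> hA; rewrite -(frob_mexp (mexp A (- t) *m X - Y) t hA) mulmxBr mulmxA.
by rewrite mexpKN mul1mx.
Qed.

Lemma mexpD n (A : 'M[C]_n) s t : mexp A (s + t) = mexp A s *m mexp A t.
Proof.
(* The product is constant in r, and r = 0 gives its value. *)
have h r : mexp A (- r) *m mexp A (r + t) = mexp A t.
  have -> : mexp A (- r) *m mexp A (r + t) = mexp A (- 0) *m mexp A (0 + t).
    apply: (mderiv0_cst (F := fun r => mexp A (- r) *m mexp A (r + t))) => q.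
    have hs : mderiv (fun r => mexp A (r + t)) q (A *m mexp A (q + t)).
      move=> i j; have [h1 h2] := mderiv_mexp A (q + t) i j.
      have ht : is_derive q (1 : R) (fun s : R => s + t) 1.
        apply: is_derive_ext (is_deriveD (is_derive_id q (1 : R))
          (is_derive_cst t q (1 : R))) _ _ => //.
        by rewrite addr0.
      split.
        by apply: is_derive_ext (@is_derive1_comp _ (fun s => Re (mexp A s i j))
          (fun s => s + t) q _ _ h1 ht) _ _ => //; rewrite mulr1.
      by apply: is_derive_ext (@is_derive1_comp _ (fun s => Im (mexp A s i j))
        (fun s => s + t) q _ _ h2 ht) _ _ => //; rewrite mulr1.
    apply: mderiv_ext (mderivM (mderiv_opp_arg (mderiv_mexp A (- q))) hs) _ _ => //.
    by rewrite mulNmx mexpC -mulmxA addNr.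
  by rewrite oppr0 mexp0 mul1mx add0r.
by rewrite -(h s) mulmxA mexpKN mul1mx.
Qed.

End MatrixCalculus.

(** * Real integrals and the balance over a random waiting time *)

Section RealIntegrals.
Variable R : realType.
Local Notation mu := (@lebesgue_measure R).

Lemma is_derive_continuous (f df : R -> R) :
  (forall t : R, is_derive t (1 : R) f (df t)) -> continuous f.
Proof.
move=> h t; apply: differentiable_continuous; apply/derivable1_diffP.
by case: (h t).
Qed.

Lemma continuous_integrable_itv (f : R -> R) a b : continuous f ->
  mu.-integrable `[a, b] (EFin \o f).
Proof.
move=> cf; apply: continuous_compact_integrable; first exact: segment_compact.
exact: continuous_subspaceT.
Qed.

Lemma Rintegral_derive (f F : R -> R) a b : a <= b ->
  (forall t : R, is_derive t (1 : R) F (f t)) -> continuous f ->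
  \int[mu]_(x in `[a, b]) f x = F b - F a.
Proof.
move=> ab hF cf; move: ab; rewrite le_eqVlt => /predU1P[<-|ab].
  by rewrite /Rintegral set_itv1 integral_set1 subrr.
rewrite /Rintegral (@continuous_FTC2 _ f F) //.
- exact: continuous_subspaceT.
- have cF := is_derive_continuous hF; split.
  + by move=> x _; case: (hF x).
  + by apply: cvg_at_right_filter; apply: cF.
  + by apply: cvg_at_left_filter; apply: cF.
- by move=> x _; rewrite derive1E; case: (hF x).
Qed.

(** Turns a bound on an extended-real integral, the form of the moment hypotheses, into the
    integrability that linearity and splitting of real integrals require. *)
Lemma ge0_integrable_le (f : R -> R) (D : set R) (M : R) : measurable D ->
  continuous f -> (forall x, D x -> 0 <= f x) ->
  (\int[mu]_(x in D) (f x)%:E <= M%:E)%E -> mu.-integrable D (EFin \o f).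
Proof.
move=> mD cf f0 fM; apply/integrableP; split.
  apply/measurable_EFinP; apply: measurable_funTS.
  exact: continuous_measurable_fun.
apply: le_lt_trans (ltry M); apply: le_trans fM.
rewrite le_eqVlt; apply/orP; left; apply/eqP; apply: eq_integral => x.
by rewrite inE => /f0 h /=; rewrite ger0_norm.
Qed.

(* Here P is a waiting-time density, y its survival function and w the energy
   still to be released; B y bounds the rate at which w leaks elsewhere. *)
Lemma released_ge_initial (y P w w' h : R -> R) (M1 Kw Kh B : R) :
  (forall t : R, is_derive t (1 : R) y (- P t)) -> continuous P ->
  (forall t, 0 <= P t) -> y 0 = 1 ->
  (\int[mu]_(t in `[0%R, +oo[) (P t)%:E = 1)%E ->
  (\int[mu]_(t in `[0%R, +oo[) (t * P t)%:E <= M1%:E)%E ->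
  (forall t : R, is_derive t (1 : R) w (w' t)) -> continuous w' ->
  (forall t, `|w t| <= Kw * y t) -> 0 <= Kw ->
  continuous h -> (forall t, 0 <= h t) -> (forall t, h t <= Kh * P t) ->
  0 <= B -> (forall t, - w' t - B * y t <= h t) ->
  w 0 - B * M1 <= \int[mu]_(t in `[0%R, +oo[) h t.
Proof.
move=> dy cP P0 y0 iP iM dw cw wy Kw0 ch h0 hP B0 hw.
have cy := is_derive_continuous dy.
have ctP : continuous (fun t : R => t * P t).
  by move=> t; apply: cvgM => //; exact: cP.
have intP : mu.-integrable `[0%R, +oo[ (EFin \o P).
  by apply: (@ge0_integrable_le _ _ 1) => //; rewrite iP.
have inttP : mu.-integrable `[0%R, +oo[ (EFin \o (fun t => t * P t)).
  apply: (@ge0_integrable_le _ _ M1) => // x /=; rewrite in_itv /= andbT => x0.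
  by rewrite mulr_ge0.
have rP : \int[mu]_(t in `[0%R, +oo[) P t = 1 by rewrite /Rintegral iP.
have rM : \int[mu]_(t in `[0%R, +oo[) (t * P t) <= M1.
  rewrite -lee_fin /Rintegral fineK //; exact: integrable_fin_num.
have inth : mu.-integrable `[0%R, +oo[ (EFin \o h).
  apply: (@le_integrable _ _ _ mu _ _ (EFin \o h) (EFin \o (fun t => Kh * P t))) => //.
  - apply/measurable_EFinP; apply: measurable_funTS.
    exact: continuous_measurable_fun.
  - by move=> x _ /=; rewrite lee_fin !ger0_norm ?(le_trans (h0 x)).
  - by apply: (integrableZl _ Kh intP).
(* Balance up to a finite horizon; what is unreleased at [T] is at most [Kw * y T], which is
   O(1/T). *)
have key T : 0 < T ->
    w 0 - B * M1 - \int[mu]_(t in `[0%R, +oo[) h t <= Kw * M1 / T.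
  move=> T0; have T0' := ltW T0.
  have tail f : mu.-integrable `[0%R, +oo[ (EFin \o f) ->
      \int[mu]_(t in `[0%R, +oo[) f t - \int[mu]_(t in `[0, T]) f t =
      \int[mu]_(t in `]T, +oo[) f t.
    by move=> intf; apply: Rintegral_itvB => //=; rewrite bnd_simp.
  have sub f : mu.-integrable `[0%R, +oo[ (EFin \o f) ->
      mu.-integrable `]T, +oo[ (EFin \o f).
    apply: integrableS => //; apply: subset_itvr.
    by rewrite bnd_simp.
  have yT : \int[mu]_(t in `]T, +oo[) P t = y T.
    rewrite -tail // rP.
    have cNP : continuous (fun t : R => - - P t).
      by move=> t; apply: cvgN; apply: cvgN; exact: cP.
    have dNy (t : R) : is_derive t (1 : R) (fun s => - y s) (- - P t).
      exact: is_deriveN.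
    have := Rintegral_derive T0' dNy cNP.
    under eq_Rintegral do rewrite opprK.
    by move=> ->; rewrite y0; ring.
  have yT0 : 0 <= y T by rewrite -yT; apply: Rintegral_ge0.
  (* Markov's inequality: beyond [T] the integrand t P(t) dominates T P(t). *)
  have mom : T * y T + \int[mu]_(t in `[0, T]) (t * P t) <= M1.
    have := tail _ inttP.
    have : T * y T <= \int[mu]_(t in `]T, +oo[) (t * P t).
      rewrite -yT -RintegralZl //; last exact: sub.
      apply: le_Rintegral => //.
      - by apply: (integrableZl _ T (sub _ intP)).
      - exact: (sub _ inttP).
      - move=> x /=; rewrite in_itv /= andbT => Tx.
        by rewrite ler_wpM2r // ltW.
    by move: rM; clear; lra.
  (* Integration by parts: (t y)' = y - t P, so the integral of [y] is the left side of [mom]. *)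
  have iy : \int[mu]_(t in `[0, T]) y t <= M1.
    have dty (t : R) : is_derive t (1 : R) (fun s => s * y s) (y t - t * P t).
      have := is_deriveM (is_derive_id t (1 : R)) (dy t).
      move=> d; apply: is_derive_eq d _; rewrite /GRing.scale /=; ring.
    have cty : continuous (fun t : R => y t - t * P t).
      by move=> t; apply: cvgB; [exact: cy|exact: ctP].
    have := Rintegral_derive T0' dty cty.
    rewrite RintegralB //; try exact: continuous_integrable_itv.
    by rewrite mul0r subr0; move: mom; clear; lra.
  have yTM : y T <= M1 / T.
    rewrite ler_pdivlMr // mulrC; apply: le_trans mom; rewrite lerDl.
    apply: Rintegral_ge0 => x /=; rewrite in_itv /= => /andP[x0 _].
    by rewrite mulr_ge0.
  have wT : w 0 - w T <= \int[mu]_(t in `[0, T]) h t + B * M1.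

    have dNw (t : R) : is_derive t (1 : R) (fun s => - w s) (- w' t).
      exact: is_deriveN.
    have cNw : continuous (fun t : R => - w' t) by move=> t; apply: cvgN; exact: cw.
    have := Rintegral_derive T0' dNw cNw.
    have : \int[mu]_(t in `[0, T]) (- w' t) <= \int[mu]_(t in `[0, T]) (h t + B * y t).
      have cBy : continuous (fun t : R => B * y t).
        by move=> t; apply: cvgM; [exact: cvg_cst|exact: cy].
      apply: le_Rintegral => //; try exact: continuous_integrable_itv.
        apply: continuous_integrable_itv => t.
        by apply: cvgD; [exact: ch|exact: cBy].
      by move=> x _; have := hw x; clear; lra.
    rewrite RintegralD //; try exact: continuous_integrable_itv; last first.
      apply: continuous_integrable_itv => t.
      by apply: cvgM; [exact: cvg_cst|exact: cy].
    rewrite RintegralZl //; last exact: continuous_integrable_itv.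
    by have := ler_wpM2l B0 iy; clear; lra.
  have hT := tail _ inth.
  have h0T : 0 <= \int[mu]_(t in `]T, +oo[) h t by exact: Rintegral_ge0.
  have := wy T; rewrite ler_norml => /andP[_ w2].
  have w3 : Kw * y T <= Kw * M1 / T by rewrite -mulrA ler_wpM2l.
  by move: wT hT h0T w2 w3; clear; lra.
rewrite -subr_le0; apply/ler_addgt0Pr => e e0; rewrite add0r.
have M10 : 0 <= M1.
  apply: le_trans rM; apply: Rintegral_ge0 => x /=; rewrite in_itv /= andbT => x0.
  by rewrite mulr_ge0.
(* Makes [Kw * M1 / T] at most [e]; the added 1 keeps [T] positive when [Kw * M1] vanishes. *)
pose T := (Kw * M1 + 1) / e.
have KM : 0 <= Kw * M1 by rewrite mulr_ge0.
have T0 : 0 < T by rewrite divr_gt0 // ltr_pwDr.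
apply: le_trans (_ : Kw * M1 / T <= _).
  by have := key T T0; clear; lra.
by rewrite ler_pdivrMr // /T [e * _]mulrC divfK ?gt_eqF //; clear; lra.
Qed.

End RealIntegrals.

(** * Renewal and energy balance *)
Section Renewal.
Variable R : realType.
Local Notation C := R[i].
Local Notation Re := (@complex.Re R).
Local Notation Im := (@complex.Im R).

Variables (dL dR dC nJ : nat).
Local Notation dS := (dL * dR)%N.
Local Notation dSC := (dS * dC)%N.
Variable J : 'I_nJ -> 'M[C]_dC.

Definition jump_rate : 'M[C]_dC := \sum_(j < nJ) dag (J j) *m J j.

Definition jump_map (s : 'M[C]_dC) : 'M[C]_dC :=
  \sum_(j < nJ) J j *m s *m dag (J j).

Lemma VC_jump_rate : VC J = 2^-1 *: jump_rate.
Proof. by []. Qed.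

Lemma VC_herm : herm (VC J).
Proof.
rewrite /herm VC_jump_rate dagZ /jump_rate dag_sum; congr (_ *: _).
  by rewrite fmorphV rmorph_nat.
by apply: eq_bigr => j _; rewrite dagM dagK.
Qed.

Lemma jump_mapD s s' : jump_map (s + s') = jump_map s + jump_map s'.
Proof.
rewrite /jump_map -big_split; apply: eq_bigr => j _.
by rewrite mulmxDr mulmxDl.
Qed.

Lemma jump_mapZ a s : jump_map (a *: s) = a *: jump_map s.
Proof.
rewrite /jump_map scaler_sumr; apply: eq_bigr => j _.
by rewrite -scalemxAr -scalemxAl.
Qed.

Lemma tr_jump_map s : \tr (jump_map s) = \tr (jump_rate *m s).
Proof.
rewrite /jump_map /jump_rate mulmx_suml !raddf_sum; apply: eq_bigr => j _.
by rewrite /= mxtrace_mulC mulmxA.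
Qed.

Variable rho0C : 'M[C]_dC.
Hypothesis rho0C_density : density_mx rho0C.
Hypothesis renewal : forall s : 'M[C]_dC, density_mx s ->
  exists c : R, 0 <= c /\ \sum_(j < nJ) J j *m s *m dag (J j) = c%:C *: rho0C.

Local Notation resets s := (jump_map s = \tr (jump_map s) *: rho0C).

(** Normalize a nonzero vector to a density matrix; taking traces identifies the constant of the
    renewal hypothesis. *)
Lemma resets_ketbra (x : 'cV[C]_dC) : resets (ketbra x).
Proof.
have [x0|x0] := eqVneq (frob x) 0.
  have -> : ketbra x = 0 *: 0 :> 'M[C]_dC.
    by rewrite (frob_eq0 x0) /ketbra mul0mx scale0r.
  by rewrite jump_mapZ scale0r mxtrace0 scale0r.
have tx : \tr (ketbra x) = (frob x ^+ 2)%:C by rewrite /ketbra tr_gram.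
have x2 : (frob x ^+ 2)%:C != 0 :> C.
  by rewrite (inj_eq (@complexI R) _ 0) expf_neq0.
pose s := (frob x ^+ 2)^-1%:C *: ketbra x.
have xs : ketbra x = (frob x ^+ 2)%:C *: s.
  by rewrite scalerA fmorphV mulfV // scale1r.
have ds : density_mx s.
  split; last by rewrite mxtraceZ tx fmorphV mulVf.
  split; first by rewrite /herm dagZ conj_real ketbra_herm.
  move=> z; rewrite -scalemxAr -scalemxAl mxE mulr_ge0 //.
    by rewrite ler0c invr_ge0 sqr_ge0.
  have -> : dag z *m ketbra x *m z = (dag z *m x) *m dag (dag z *m x).
    by rewrite dagM dagK /ketbra !mulmxA.
  have := tr_gram (dag z *m x); rewrite /mxtrace big_ord1 => ->.
  by rewrite ler0c sqr_ge0.
have [c [_ cE]] := renewal ds; rewrite -/(jump_map s) in cE.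
by rewrite xs jump_mapZ cE !mxtraceZ rho0C_density.2 mulr1 scalerA.
Qed.

(* Polarization: density matrices span all matrices. *)
Lemma jump_map_resets (s : 'M[C]_dC) : resets s.
Proof.
have resetsD a b : resets a -> resets b -> resets (a + b).
  by move=> ha hb; rewrite jump_mapD mxtraceD scalerDl -ha -hb.
have resetsZ c a : resets a -> resets (c *: a).
  by move=> ha; rewrite jump_mapZ mxtraceZ -scalerA -ha.
have resets_sum (I : Type) (r : seq I) (F : I -> 'M[C]_dC) :
    (forall i, resets (F i)) -> resets (\sum_(i <- r) F i).
  move=> h; apply: (big_ind (fun a => resets a)) => [|a b|i _].
  - by rewrite -(scale0r 0) jump_mapZ scale0r mxtrace0 scale0r.
  - exact: resetsD.
  - exact: h.
have resets_dyad (x z : 'cV[C]_dC) : resets (x *m dag z).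
  (* Two ketbras suffice besides those of x and z: the real combination gives xz^dag + zx^dag and
     the imaginary one xz^dag - zx^dag. *)
  have -> : x *m dag z = 2^-1 *: (ketbra (x + z) +
      (iC R *: ketbra (x + iC R *: z) +
       (- (1 + iC R)) *: (ketbra x + ketbra z))).
    rewrite /ketbra !dagD dagZ conj_iC !(mulmxDl, mulmxDr).
    rewrite -!scalemxAl -!scalemxAr.
    have i2 : iC R * iC R = -1 := iC_mul_iC R.
    apply/matrixP => i j; rewrite !mxE.
    move: (\sum_j0 _) (\sum_j0 _) (\sum_j0 _) (\sum_j0 _) => p q r t.
    apply: (@mulfI _ 2); first by rewrite pnatr_eq0.
    rewrite mulrA mulfV ?pnatr_eq0 // mul1r.
    rewrite !mulNr !mulrN !mulrDr !mulrN !mulrA !i2 !mulrDl !mulNr !mul1r.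
    by ring.
  apply: (resetsZ); apply: (resetsD); first exact: resets_ketbra.
  apply: (resetsD); first by apply: (resetsZ); exact: resets_ketbra.
  by apply: (resetsZ); apply: (resetsD); exact: resets_ketbra.
rewrite [s]matrix_sum_delta; apply: (resets_sum) => i; apply: (resets_sum) => j.
apply: (resetsZ); have -> : delta_mx i j = (delta_mx i 0 : 'cV[C]_dC) *m
    dag (delta_mx j 0 : 'cV[C]_dC).
  have -> : dag (delta_mx j 0 : 'cV[C]_dC) = delta_mx 0 j.
    by apply/matrixP => a b; rewrite dagE !mxE rmorph_nat andbC.
  by rewrite mul_delta_mx.
exact: resets_dyad.
Qed.

Definition blk (X : 'M[C]_dSC) (i j : 'I_dS) : 'M[C]_dC :=
  \matrix_(a, b) X (mxtens_index (i, a)) (mxtens_index (j, b)).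

Lemma blk_mull (A : 'M[C]_dC) X i j : blk ((1%:M *t A) *m X) i j = A *m blk X i j.
Proof.
apply/matrixP => a b; rewrite !mxE mxtens_sum (bigD1 i) //= [X in _ + X]big1.
  by rewrite addr0; apply: eq_bigr => c _; rewrite tensmxE !mxE eqxx mul1r.
move=> k /negPf ki; apply: big1 => c _.
by rewrite tensmxE !mxE eq_sym ki !mul0r.
Qed.

Lemma blk_mulr (A : 'M[C]_dC) X i j : blk (X *m (1%:M *t A)) i j = blk X i j *m A.
Proof.
apply/matrixP => a b; rewrite !mxE mxtens_sum (bigD1 j) //= [X in _ + X]big1.
  by rewrite addr0; apply: eq_bigr => c _; rewrite tensmxE !mxE eqxx mul1r.
move=> k /negPf ki; apply: big1 => c _.
by rewrite tensmxE !mxE ki mul0r mulr0.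
Qed.

Lemma ptr2_blk X i j : ptr2 X i j = \tr (blk X i j).
Proof. by rewrite mxE /mxtrace; apply: eq_bigr => k _; rewrite mxE. Qed.

(** Renewal acts on each C-block by [jump_map]. Blocks are arbitrary matrices, which is why
    [jump_map_resets] goes beyond density matrices. *)
Lemma Dre_tens (X : 'M[C]_dSC) :
  Dre J X = ptr2 ((1%:M *t jump_rate) *m X) *t rho0C.
Proof.
apply/matrixP => i0 j0; case: (mxtens_indexP i0) => i a.
case: (mxtens_indexP j0) => j b.
rewrite tensmxE ptr2_blk blk_mull -tr_jump_map.
have -> : \tr (jump_map (blk X i j)) * rho0C a b = jump_map (blk X i j) a b.
  by rewrite [in RHS]jump_map_resets mxE.
rewrite /Dre /jump_map !summxE; apply: eq_bigr => k _.
by rewrite dag_tens dag1 -blk_mull -blk_mulr !mxE.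
Qed.

Lemma gram_Dre (X : 'M[C]_dSC) : gram X -> gram (Dre J X).
Proof. by move=> gX; apply: gram_sum => j; apply: gram_congr. Qed.

Lemma mxtrace_tens m n (A : 'M[C]_m) (B : 'M[C]_n) : \tr (A *t B) = \tr A * \tr B.
Proof. by rewrite -mxtrace_ptr2 ptr2_tens mxtraceZ mulrC. Qed.

Lemma tr_Dre (X : 'M[C]_dSC) : \tr (Dre J X) = \tr ((1%:M *t jump_rate) *m X).
Proof. by rewrite Dre_tens mxtrace_tens rho0C_density.2 mulr1 mxtrace_ptr2. Qed.

Lemma tr_mul_tens m n (X : 'M[C]_(m * n)) (S : 'M[C]_m) (r : 'M[C]_n) :
  \tr (X *m (S *t r)) = \tr (ptr2 (X *m (1%:M *t r)) *m S).
Proof.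
rewrite [RHS]mxtrace_mulC mxtrace_mul_ptr2 [RHS]mxtrace_mulC -mulmxA.
by rewrite tensmx_mul mul1mx mulmx1.
Qed.

Variable Hsc : 'M[C]_dSC.
Hypothesis Hsc_herm : herm Hsc.

(** The non-Hermitian effective generator -iH - V, with which the no-renewal evolution becomes X ->
    G X + X G^dag. *)
Definition nore_gen : 'M[C]_dSC := - (iC R *: Hsc) - 1%:M *t VC J.

Lemma Lnore_gen X : Lnore J Hsc X = nore_gen *m X + X *m dag nore_gen.
Proof.
rewrite /Lnore /nore_gen dagB dagN dagZ conj_iC Hsc_herm dag_tens dag1 VC_herm.
rewrite mulmxBl mulmxBr mulNmx scaleNr opprK -scalemxAl -scalemxAr.
by rewrite scalerBr; apply/matrixP => i j; rewrite !mxE; ring.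
Qed.

Lemma tr_comm n (A B D : 'M[C]_n) : A *m B = B *m A ->
  \tr (A *m (B *m D - D *m B)) = 0.
Proof.
move=> AB; rewrite mulmxBr raddfB /= [X in _ - \tr X]mulmxA.
by rewrite [X in _ - X]mxtrace_mulC !mulmxA AB subrr.
Qed.

(* The local Hamiltonian HC of C commutes with A (x) 1 and drops out. *)
Lemma tr_Lnore (A : 'M[C]_dS) (HC : 'M[C]_dC) (X : 'M[C]_dSC) :
  let Ht := Hsc - 1%:M *t HC in
  \tr ((A *t 1%:M) *m Lnore J Hsc X) =
  - (iC R * \tr ((A *t 1%:M) *m (Ht *m X - X *m Ht)))
  - \tr (A *m ptr2 ((1%:M *t jump_rate) *m X)).
Proof.
move=> Ht; rewrite /Lnore mulmxBr raddfB /= mulmxN raddfN /= -scalemxAr mxtraceZ.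
congr (- (_ * _) - _).
  have -> : Hsc = Ht + 1%:M *t HC by rewrite /Ht subrK.
  clearbody Ht.
  have -> : (Ht + 1%:M *t HC) *m X - X *m (Ht + 1%:M *t HC) =
     (Ht *m X - X *m Ht) + ((1%:M *t HC) *m X - X *m (1%:M *t HC)).
    by rewrite mulmxDl mulmxDr; apply/matrixP => i j; rewrite !mxE; ring.
  rewrite mulmxDr mxtraceD [X in _ + X]tr_comm ?addr0 //.
  by rewrite !tensmx_mul !mulmx1 !mul1mx.
rewrite mxtrace_mul_ptr2 mulmxDr mxtraceD.
have -> : \tr ((A *t 1%:M) *m (X *m (1%:M *t VC J))) =
          \tr ((A *t 1%:M) *m ((1%:M *t VC J) *m X)).
  rewrite [X in \tr X = _]mulmxA [LHS]mxtrace_mulC !mulmxA !tensmx_mul.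
  by rewrite !mulmx1 !mul1mx.
rewrite VC_jump_rate tensmxZr -scalemxAl -scalemxAr mxtraceZ -mulrDl.
rewrite -[X in (X + _) * _]mul1r -[X in (_ + X) * _]mul1r -mulrDl.
by rewrite (_ : 1 + 1 = 2) // mulfV ?pnatr_eq0 // mul1r.
Qed.

Variable E : R -> 'M[C]_dSC -> 'M[C]_dSC.
Hypothesis E_flow : is_flow (Lnore J Hsc) E.

Lemma flowE t X : E t X = mexp nore_gen t *m X *m dag (mexp nore_gen t).
Proof. exact: flow_mexp Lnore_gen E_flow t X. Qed.

Lemma gram_flow t X : gram X -> gram (E t X).
Proof. by move=> gX; rewrite flowE; apply: gram_congr. Qed.

Lemma is_derive_flow (A X : 'M[C]_dSC) (t : R) :
  is_derive t (1 : R) (fun s => Re (\tr (A *m E s X)))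
    (Re (\tr (A *m Lnore J Hsc (E t X)))).
Proof.
apply: is_derive_Re_tr; apply: mderivMl.
by have [_ h] := E_flow X; exact: h.
Qed.

Lemma continuous_flow (A X : 'M[C]_dSC) :
  continuous (fun s : R => Re (\tr (A *m E s X))).
Proof. exact: (is_derive_continuous (is_derive_flow A X)). Qed.

Lemma tr_Lnore_adj (A X : 'M[C]_dSC) :
  \tr (A *m Lnore J Hsc X) = \tr ((A *m nore_gen + dag nore_gen *m A) *m X).
Proof.
rewrite Lnore_gen mulmxDr mulmxDl !mxtraceD mulmxA; congr (_ + _).
by rewrite mulmxA mxtrace_mulC mulmxA.
Qed.

Variables (tau : nat -> R) (rhoS0 : 'M[C]_dS).
Hypothesis rhoS0_density : density_mx rhoS0.
Hypothesis Pren_int : forall l' : nat,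
  (\int[@lebesgue_measure R]_(t in `[0%R, +oo[) (Pren J E tau rhoS0 rho0C l' t)%:E
     = 1)%E.

Local Notation init l := (init_state J E tau rhoS0 rho0C l).
Local Notation rho l t := (unnorm_state J E tau rhoS0 rho0C l t).
Local Notation P l t := (Pren J E tau rhoS0 rho0C l t).

Lemma gram_init l : gram (init l).
Proof.
elim: l => [|l IH] /=.
  by apply: gram_tens; apply: psd_gram;
    [have [] := rhoS0_density|have [] := rho0C_density].
set X := Dre _ _; have gX : gram X by apply: gram_Dre; apply: gram_flow.
have [X0 XE] := gram_tr gX.
by rewrite /tr_normalize XE -fmorphV; apply: gramZ; rewrite ?invr_ge0.
Qed.

Lemma PrenE l t : P l t = Re (\tr ((1%:M *t jump_rate) *m rho l t)).
Proof. by rewrite /Pren tr_Dre. Qed.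

(* A vanishing renewal probability would normalize 0/0 to the zero matrix; this is
   excluded because the renewal density integrates to 1. *)
Lemma init_neq0 l : init l <> 0.
Proof.
move=> i0; have := Pren_int l.
rewrite (eq_integral (fun=> 0%E)) ?integral0; last first.
  move=> t _; rewrite PrenE /unnorm_state i0 flowE mulmx0 mul0mx mulmx0.
  by rewrite mxtrace0.
by move=> /eqP; rewrite eq_sym onee_eq0.
Qed.

Lemma tr_init l : \tr (init l) = 1.
Proof.
case: l => [|l].
  by rewrite /= mxtrace_tens rhoS0_density.2 rho0C_density.2 mulr1.
have := @init_neq0 l.+1; rewrite /=; set X := Dre _ _ => X0.
rewrite /tr_normalize mxtraceZ mulVf //; apply/eqP => tX; apply: X0.
rewrite (gram_tr0 _ tX) /tr_normalize ?scaler0 //.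
by apply: gram_Dre; apply: gram_flow; apply: gram_init.
Qed.

Lemma init_tens l : exists S : 'M[C]_dS, init l = S *t rho0C /\ \tr S = 1.
Proof.
suff [S SE] : exists S : 'M[C]_dS, init l = S *t rho0C.
  exists S; split => //; have := tr_init l.
  by rewrite SE mxtrace_tens rho0C_density.2 mulr1.
case: l => [|l]; first by exists rhoS0.
rewrite /= Dre_tens /tr_normalize.
by eexists; rewrite -tensmxZl.
Qed.

Lemma gram_rho l t : gram (rho l t).
Proof. by apply: gram_flow; apply: gram_init. Qed.

Lemma gram_tr_le n (A X : 'M[C]_n) : gram X ->
  `|Re (\tr (A *m X))| <= frob A * Re (\tr X).
Proof.
move=> [m [Y ->]]; rewrite rip_tr tr_gram ReC.
apply: le_trans (norm_rip_le_frob _ _) _; rewrite expr2 mulrCA ler_wpM2l ?frob_ge0 //.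
exact: frobM.
Qed.

(** With X = Y Y^dag each half of the commutator is an inner product of images of Y. By
    [frob_tens1M] only the norm of [A] on S enters, as in the definition of the parameter
    eps^0_H. *)
Lemma gram_tr_comm_le (A : 'M[C]_dS) (B X : 'M[C]_dSC) : gram X ->
  Re (iC R * \tr ((A *t 1%:M) *m (B *m X - X *m B))) <=
  2 * (frob A * frob B) * Re (\tr X).
Proof.
move=> [m [Y ->]]; rewrite tr_gram ReC mulmxBr raddfB /= mulrBr ReD ReN.
set A1 := A *t _.
have b1 : Re (iC R * \tr (A1 *m (B *m (Y *m dag Y)))) <=
    frob A * frob B * frob Y ^+ 2.
  have -> : Re (iC R * \tr (A1 *m (B *m (Y *m dag Y)))) =
      rip (dag A1 *m Y) (iC R *: (B *m Y)).
    rewrite rip_mull dagK /rip -!scalemxAr mxtraceZ.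
    by rewrite [X in _ = Re (_ * X)]mxtrace_mulC !mulmxA.
  apply: le_trans (rip_le_frob _ _) _; rewrite frob_iC.
  have h1 : frob (dag A1 *m Y) <= frob A * frob Y.
    by rewrite /A1 dag_tens dag1 -[frob A]frob_dag frob_tens1M.
  have h2 := frobM B Y.
  have := ler_pM (frob_ge0 _) (frob_ge0 _) h1 h2.
  by rewrite mulrACA -expr2.
have b2 : - Re (iC R * \tr (A1 *m (Y *m dag Y *m B))) <=
    frob A * frob B * frob Y ^+ 2.
  have -> : - Re (iC R * \tr (A1 *m (Y *m dag Y *m B))) =
      rip (- (dag B *m Y)) (iC R *: (A1 *m Y)).
    rewrite ripNl rip_mull dagK /rip -!scalemxAr mxtraceZ; congr (- Re (_ * _)).
    by rewrite -(mulmxA Y) [X in \tr X = _]mulmxA [LHS]mxtrace_mulC !mulmxA.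
  apply: le_trans (rip_le_frob _ _) _; rewrite frob_iC frobN.
  have h1 : frob (A1 *m Y) <= frob A * frob Y by exact: frob_tens1M.
  have h2 := frobM (dag B) Y; rewrite frob_dag in h2.
  have := ler_pM (frob_ge0 _) (frob_ge0 _) h2 h1.
  by rewrite mulrACA -expr2 [frob B * _]mulrC.
apply: le_trans (lerD b1 b2) _.
by rewrite -[leRHS]mulrA mulr_natl mulr2n lexx.
Qed.

Definition init_energy l : R := Re (\tr (Hsc *m init l)).

(** Apply [released_ge_initial] to the expectation of [W]: renewals release it as energy, and the
    commutator with H~ is its only leak, at rate at most 2 |A| |H~| times the survival
    probability. *)
Lemma init_energy_le_Pin l (T0 M1 eps0 : R) (HC : 'M[C]_dC) :
  0 < T0 -> gram Hsc ->
  (\int[@lebesgue_measure R]_(t in `[0%R, +oo[) (t * P l t)%:E <= M1%:E)%E ->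
  frob (ptr2 ((Hsc - 1%:M *t HC) *m (1%:M *t rho0C))) * frob (Hsc - 1%:M *t HC)
     * 2 * M1 * T0 <= eps0 ->
  T0 * init_energy l <= T0 ^+ 2 * Pin J E tau rhoS0 rho0C T0 Hsc l + eps0.
Proof.
move=> T0p gH iM; set Ht := Hsc - _; set A := ptr2 _ => heps.
pose c := \tr (HC *m rho0C).
(* On a product S (x) rho0C with tr S real, [W] and [Hsc] have expectations with equal real part;
   [W] acts on S alone, so [HC] drops out of its evolution. *)
pose W : 'M[C]_dSC := (Re c)%:C *: 1%:M + A *t 1%:M.
pose y (t : R) := Re (\tr ((1%:M : 'M[C]_dSC) *m rho l t)).
have yE t : y t = Re (\tr (rho l t)) by rewrite /y mul1mx.
have HD (X : 'M[C]_dSC) S : X = S *t rho0C -> Im (\tr S) = 0 ->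
    Re (\tr (Hsc *m X)) = Re c * Re (\tr X) + Re (\tr (A *m S)).
  move=> XE iS; have -> : Hsc = Ht + 1%:M *t HC by rewrite /Ht subrK.
  rewrite mulmxDl mxtraceD ReD XE tr_mul_tens addrC; congr (_ + _).
  rewrite tensmx_mul mul1mx !mxtrace_tens rho0C_density.2 mulr1 -/c ReM iS.
  by ring.
have Wtr X : Re (\tr (W *m X)) = Re c * Re (\tr X) + Re (\tr ((A *t 1%:M) *m X)).
  by rewrite mulmxDl mxtraceD ReD -scalemxAl mul1mx mxtraceZ ReCM.
have dy (t : R) : is_derive t (1 : R) y (- P l t).
  apply: is_derive_eq (is_derive_flow 1%:M (init l) t) _; rewrite PrenE.
  have := tr_Lnore 1%:M HC (rho l t); rewrite /= tens1mx1 => ->.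
  rewrite tr_comm ?mulmx1 ?mul1mx // mulr0 oppr0 add0r ReN mxtrace_ptr2.
  by [].
have rel : init_energy l - 2 * (frob A * frob Ht) * M1 <=
    \int[@lebesgue_measure R]_(t in `[0%R, +oo[) Re (\tr (Hsc *m Dre J (rho l t))).
  have -> : init_energy l = Re (\tr (W *m rho l 0)).
    rewrite /unnorm_state (E_flow _).1 /init_energy Wtr.
    have [S [SE S1]] := init_tens l.
    rewrite (HD _ _ SE) ?S1 // SE tensmx_mul mul1mx [X in _ = _ + Re X]mxtrace_tens.
    by rewrite rho0C_density.2 mulr1.
  apply: (@released_ge_initial R y (fun t => P l t)
    (fun t => Re (\tr (W *m rho l t)))
    (fun t => Re (\tr (W *m Lnore J Hsc (rho l t)))) _ M1 (frob W) (frob Hsc)) => //.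
  - move=> t; have := @continuous_flow (1%:M *t jump_rate) (init l) t.
    by under eq_fun do rewrite -PrenE.
  - by move=> t; apply: (gram_tr (gram_Dre (gram_rho l t))).1.
  - by rewrite yE /unnorm_state (E_flow _).1 tr_init.
  - by move=> t; exact: is_derive_flow.
  - under eq_fun do rewrite tr_Lnore_adj.
    exact: continuous_flow.
  - by move=> t; rewrite yE; apply: gram_tr_le; exact: gram_rho.
  - exact: frob_ge0.
  - have HDre X : \tr (Hsc *m Dre J X) =
        \tr ((\sum_j dag (1%:M *t J j) *m Hsc *m (1%:M *t J j)) *m X).
      rewrite /Dre mulmx_sumr mulmx_suml !raddf_sum; apply: eq_bigr => j _ /=.
      by rewrite !mulmxA mxtrace_mulC !mulmxA.
    under eq_fun do rewrite HDre.
    exact: continuous_flow.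
  - by move=> t; apply: gram_mul_tr_ge0 => //; apply: gram_Dre; exact: gram_rho.
  - move=> t; apply: le_trans (ler_norm _) _; apply: gram_tr_le.
    by apply: gram_Dre; exact: gram_rho.
  - by rewrite !mulr_ge0 ?frob_ge0.
  - move=> t; have gr := gram_rho l t.
    have := gram_tr_comm_le A Ht gr; rewrite yE.
    have -> : Re (\tr (Hsc *m Dre J (rho l t))) =
       Re c * P l t + Re (\tr (A *m ptr2 ((1%:M *t jump_rate) *m rho l t))).
      rewrite (HD _ _ (Dre_tens _)) // mxtrace_ptr2 -tr_Dre.
      by rewrite (gram_tr (gram_Dre gr)).2.
    have -> : Re (\tr (W *m Lnore J Hsc (rho l t))) = Re c * (- P l t) +
       Re (\tr ((A *t 1%:M) *m Lnore J Hsc (rho l t))).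
      rewrite Wtr; congr (_ * _ + _).
      (* Two expressions for the derivative of [y], identified by uniqueness of derivatives, give
         the trace of the generator. *)
      have [d1 d2] := dy t.
      have [d3 d4] := is_derive_flow 1%:M (init l) t.
      rewrite -d2 -[RHS]/('D_1 (fun s => Re (\tr (1%:M *m E s (init l)))) t).
      by rewrite d4 mul1mx.
    rewrite (tr_Lnore A HC) -/Ht ReD !ReN.
    by clear; lra.
rewrite /Pin expr2 -mulrA mulVKf ?gt_eqF //.
have := ler_wpM2l (ltW T0p) rel; move: heps.
set b := \int[_]_(_ in _) _; clearbody b; clear; lra.
Qed.

End Renewal.

(** * Speed limits *)
Section SpeedLimits.
Variable R : realType.
Local Notation C := R[i].
Local Notation Re := (@complex.Re R).
Local Notation Im := (@complex.Im R).
Local Notation mu := (@lebesgue_measure R).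

Lemma is_derive_ge0_le (f df : R -> R) (a b : R) : a <= b ->
  (forall t : R, is_derive t (1 : R) f (df t)) -> (forall t, 0 <= df t) ->
  f a <= f b.
Proof.
move=> ab d d0.
have h1 x : x \in `]a, b[%R -> derivable f x 1 by case: (d x).
have h2 x : x \in `]a, b[%R -> 0 <= f^`()%classic x.
  by move=> _; rewrite derive1E; case: (d x) => _ ->.
apply: (ger0_derive1_le h1 h2 (sa := true) (sb := false)) => //.
- exact/continuous_subspaceT/(is_derive_continuous d).
- by rewrite in_itv /= lexx.
- by rewrite in_itv /= lexx ab.
Qed.

Variables (n : nat) (H : 'M[C]_n).
Hypothesis H_herm : herm H.
Local Notation A := (- (iC R *: H)).

Lemma iH_antiherm : dag A = - A.
Proof. by rewrite dagN dagZ conj_iC H_herm scaleNr. Qed.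

Lemma H_mexpC t : H *m mexp A t = mexp A t *m H.
Proof.
have := mexpC A t; rewrite mulNmx mulmxN -scalemxAl -scalemxAr => /oppr_inj.
move=> /(congr1 (fun X => - iC R *: X)); rewrite !scalerA mulNr iC_mul_iC opprK.
by rewrite !scale1r.
Qed.

Lemma energy_mexp m (X : 'M[C]_(n, m)) t :
  rip (mexp A t *m X) (H *m (mexp A t *m X)) = rip X (H *m X).
Proof.
rewrite [H *m _]mulmxA H_mexpC -mulmxA rip_mull [X in rip _ X]mulmxA.
by rewrite dag_mexp_unitary ?iH_antiherm // mul1mx.
Qed.

(* Margolus-Levitin with a non-optimal constant. *)
Lemma overlap_ge_energy m (X : 'M[C]_(n, m)) (t : R) : gram H -> 0 <= t ->
  rip X X - t * rip X (H *m X) <= rip X (mexp A t *m X).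
Proof.
move=> [p [W HW]] t0; set e := rip X (H *m X).
(* Nondecreasing: the overlap falls at rate at most [e], by Cauchy-Schwarz in the form of H and
   conservation of energy. *)
pose f (s : R) := rip X (mexp A s *m X) + s * e.
have Hrip (Y Z : 'M[C]_(n, m)) : rip Y (H *m Z) = rip (dag W *m Y) (dag W *m Z).
  by rewrite rip_mull dagK mulmxA -HW.
have df (s : R) : is_derive s (1 : R) f (rip X (A *m (mexp A s *m X)) + e).
  have d1 := is_derive_rip X (mderivMr X (mderiv_mexp A s)).
  have d2 := is_deriveM_real (is_derive_id s (1 : R)) (is_derive_cst e s (1 : R)).
  apply: is_derive_ext (is_deriveD d1 d2) _ _ => //.
  by rewrite mulmxA mul1r mulr0 addr0.
suff : f 0 <= f t.
  by rewrite /f mexp0 mul1mx mul0r addr0; move: (rip X _) => q; clear; lra.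
apply: is_derive_ge0_le t0 df _ => s.
have nW : frob (dag W *m (mexp A s *m X)) = frob (dag W *m X).
  by apply: frob_eq; rewrite -!Hrip energy_mexp.
rewrite mulNmx ripNr -scalemxAl rip_iC Hrip -scalemxAr opprK.
have := norm_rip_le_frob (iC R *: (dag W *m X)) (dag W *m (mexp A s *m X)).
rewrite frob_iC nW ler_norml => /andP[h _].
have -> : e = frob (dag W *m X) * frob (dag W *m X) by rewrite /e Hrip -sqr_frob expr2.
by move: h; clear; lra.
Qed.

Definition phase (h t : R) : C := cos (h * t) +i* sin (h * t).

Lemma norm_phase h t : `|phase h t| = 1.
Proof. by rewrite normc_def /= cos2Dsin2 sqrtr1. Qed.

Lemma cderiv_phase (h t : R) : cderiv (phase h) t (h%:C * iC R * phase h t).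
Proof.
have dl : is_derive t (1 : R) (fun s : R => h * s) h.
  apply: is_derive_ext (is_deriveM_real (is_derive_cst h t (1 : R))
    (is_derive_id t (1 : R))) _ _ => //.
  by rewrite mul0r mulr1 add0r.
have pR : Re (phase h t) = cos (h * t) by [].
have pI : Im (phase h t) = sin (h * t) by [].
move: (phase h t) pR pI => p pR pI.
split; rewrite !(ReM, ImM, ReC, ImC, Re_iC, Im_iC) pR pI.
  apply: is_derive_ext (@is_derive1_comp _ (@cos R) (fun s => h * s) t _ _
    (is_derive_cos _) dl) _ _ => //.
  by ring.
apply: is_derive_ext (@is_derive1_comp _ (@sin R) (fun s => h * s) t _ _
  (is_derive_sin _) dl) _ _ => //.
by ring.
Qed.

(* Mandelstam-Tamm with a non-optimal constant; the phase absorbs the mean energy h. *)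
Lemma overlap_ge_spread m (X : 'M[C]_(n, m)) (h t : R) : 0 <= t ->
  rip X X - t * (frob (H *m X - h%:C *: X) * frob X) <=
  rip X (phase h t *: (mexp A t *m X)).
Proof.
move=> t0; set e := frob _ * frob _.
pose F (s : R) := phase h s *: (mexp A s *m X).
pose f (s : R) := rip X (F s) + s * e.
(* [F] follows the Schroedinger equation of H - h, so the overlap changes no faster than the spread
   around [h]. *)
have dF s : mderiv F s (- (iC R *: (H *m F s - h%:C *: F s))).
  apply: mderiv_ext (mderivZ (cderiv_phase h s)
    (mderivMr X (mderiv_mexp A s))) _ _ => //.
  have -> : A *m mexp A s *m X = - (iC R *: (H *m (mexp A s *m X))).
    by rewrite !mulNmx -!scalemxAl mulmxA.
  rewrite /F -scalemxAr; move: (H *m (mexp A s *m X)) => M.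
  move: (mexp A s *m X) => Z.
  by apply/matrixP => i j; rewrite !mxE; ring.
have df (s : R) : is_derive s (1 : R) f
    (rip X (- (iC R *: (H *m F s - h%:C *: F s))) + e).
  have d1 := is_derive_rip X (dF s).
  have d2 := is_deriveM_real (is_derive_id s (1 : R)) (is_derive_cst e s (1 : R)).
  apply: is_derive_ext (is_deriveD d1 d2) _ _ => //.
  by rewrite mul1r mulr0 addr0.
have nF s : frob (F s) = frob X.
  by rewrite /F frob_unimodular ?norm_phase // frob_mexp // iH_antiherm.
suff : f 0 <= f t.
  rewrite /f /F mexp0 mul1mx mul0r addr0 /phase mulr0 cos0 sin0 scale1r.
  by move: (rip X _) => q; clear; lra.
apply: is_derive_ge0_le t0 df _ => s.
have -> : rip X (- (iC R *: (H *m F s - h%:C *: F s))) =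
    rip (iC R *: (H *m X - h%:C *: X)) (F s).
  rewrite ripNr rip_iC opprK ripDr ripNr ripZr -{1}H_herm -rip_mull.
  rewrite scalerBr ripDl ripNl -scalemxAr [X in _ = _ - rip X _]scalerA.
  by rewrite [iC R * h%:C]mulrC -scalerA ripZl.
have := norm_rip_le_frob (iC R *: (H *m X - h%:C *: X)) (F s).
rewrite frob_iC nF ler_norml => /andP[h' _].
by rewrite -/e in h'; move: h'; clear; lra.
Qed.

Variable V : 'M[C]_n.
Local Notation G := (A - V).

Lemma mderiv_damping m (Y : 'M[C]_(n, m)) (s : R) :
  mderiv (fun r => V *m (mexp G r *m Y)) s (V *m ((G *m mexp G s) *m Y)).
Proof. by apply: mderivMl; apply: mderivMr; exact: mderiv_mexp. Qed.

Lemma continuous_damping m (Y : 'M[C]_(n, m)) :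
  continuous (fun s : R => frob (V *m (mexp G s *m Y))).
Proof.
have -> : (fun s : R => frob (V *m (mexp G s *m Y))) = Num.sqrt \o
   (fun s : R => Re (\tr (dag (V *m (mexp G s *m Y)) *m (V *m (mexp G s *m Y))))).
  by apply/funext => s; rewrite /= -/(rip _ _) -sqr_frob sqrtr_sqr ger0_norm ?frob_ge0.
move=> s; apply: continuous_comp; last exact: sqrt_continuous.
by apply: (is_derive_continuous (fun r => is_derive_Re_tr
  (mderivM (mderiv_dag (mderiv_damping Y r)) (mderiv_damping Y r)))).
Qed.

(* Passing to the interaction picture of the unitary part leaves only the
   damping V to integrate. *)
Lemma drift_le m (Y : 'M[C]_(n, m)) (t : R) : 0 <= t ->
  frob (mexp G t *m Y - mexp A t *m Y) <=
  \int[mu]_(s in `[0, t]) frob (V *m (mexp G s *m Y)).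
Proof.
move=> t0; set q := \int[mu]_(_ in _) _.
pose W (s : R) := mexp A (- s) *m (mexp G s *m Y).
have dW s : mderiv W s (- (mexp A (- s) *m (V *m (mexp G s *m Y)))).
  apply: mderiv_ext (mderivM (mderiv_opp_arg (mderiv_mexp A (- s)))
    (mderivMr Y (mderiv_mexp G s))) _ _ => //.
  rewrite mexpC; move: (mexp A (- s)) (mexp G s) => K M; move: A => B.
  by rewrite -!mulmxA mulmxBl mulmxBr mulNmx -!mulmxA addrA addNr add0r.
have W0 : W 0 = Y by rewrite /W oppr0 !mexp0 !mul1mx.
(* Pairing with the fixed matrix [D] reduces to a scalar integral and gives |D|^2 <= |D| q. *)
pose D := W t - Y.
have ND : frob D = frob (mexp G t *m Y - mexp A t *m Y).
  exact: frob_mexp_opp iH_antiherm.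
pose g (s : R) := - rip D (mexp A (- s) *m (V *m (mexp G s *m Y))).
have dg (s : R) : is_derive s (1 : R) (fun r => rip D (W r)) (g s).
  by rewrite /g -ripNr; exact: is_derive_rip.
have crip p (Z : 'M[C]_(p, m)) (F : R -> 'M[C]_(p, m)) (F' : R -> 'M[C]_(p, m)) :
    (forall s, mderiv F s (F' s)) -> continuous (fun s : R => rip Z (F s)).
  by move=> dF; apply: (is_derive_continuous (fun s => is_derive_rip Z (dF s))).
have cg : continuous g.
  move=> s; apply: cvgN.
  by apply: (crip _ D _ _ (fun r => mderivM (mderiv_opp_arg (mderiv_mexp A (- r)))
    (mderiv_damping Y r))).
have cV := @continuous_damping _ Y.
have gle s : g s <= frob D * frob (V *m (mexp G s *m Y)).
  rewrite /g -ripNl; apply: le_trans (rip_le_frob _ _) _.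
  by rewrite frobN frob_mexp ?iH_antiherm.
have DD : frob D * frob D <= frob D * q.
  have := Rintegral_derive t0 dg cg.
  have -> : rip D (W t) - rip D (W 0) = frob D * frob D.
    by rewrite W0 -ripNr -ripDr -/D -sqr_frob expr2.
  move=> <-; rewrite /q -RintegralZl //; last exact: continuous_integrable_itv.
  apply: le_Rintegral => //; try exact: continuous_integrable_itv.
  apply: continuous_integrable_itv => s.
  by apply: cvgM; [exact: cvg_cst|exact: cV].
rewrite -ND; have [->|D0] := eqVneq (frob D) 0.
  by apply: Rintegral_ge0 => s _; exact: frob_ge0.
by move: DD; rewrite ler_pM2l // lt_neqAle eq_sym D0 frob_ge0.
Qed.

Lemma drift_le_later m (Y : 'M[C]_(n, m)) (t T : R) : 0 <= t -> t <= T ->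
  frob (mexp G t *m Y - mexp A t *m Y) <=
  \int[mu]_(s in `[0, T]) frob (V *m (mexp G s *m Y)).
Proof.
move=> t0 tT; apply: le_trans (drift_le Y t0) _; rewrite -subr_ge0.
rewrite Rintegral_itvB //= ?bnd_simp //.
  by apply: Rintegral_ge0 => s _; exact: frob_ge0.
by apply: continuous_integrable_itv; exact: continuous_damping.
Qed.

Lemma frob_compl_near k (T : 'M[C]_n) (X Y : 'M[C]_(n, k)) : is_proj T ->
  frob (X - T *m X) <= frob (Y - T *m Y) + frob (Y - X).
Proof.
move=> pT; have -> : X - T *m X = (Y - T *m Y) + - ((Y - X) - T *m (Y - X)).
  by rewrite mulmxBr; apply/matrixP => i j; rewrite !mxE; ring.
apply: le_trans (frobD _ _) _; rewrite frobN lerD2l.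
exact: frob_proj_compl_le.
Qed.

Lemma frobB_le k p (X Y : 'M[C]_(k, p)) : frob X <= frob Y + frob (X - Y).
Proof. by rewrite -{1}[X](addrNK Y) addrC; exact: frobD. Qed.

Lemma frobBC k p (X Y : 'M[C]_(k, p)) : frob (X - Y) = frob (Y - X).
Proof. by rewrite -frobN opprB. Qed.

Lemma frob_near_unit k p (X Y : 'M[C]_(k, p)) : frob Y = 1 ->
  frob (X - Y) <= 8 / 1000 -> 992 / 1000 <= frob X <= 1008 / 1000.
Proof.
move=> Y1; have := frobB_le X Y; have := frobB_le Y X; rewrite [frob (Y - X)]frobBC Y1.
by move=> h1 h2 h; apply/andP; split; lra.
Qed.

(* F0, F1 are purifications under the unitary flow and S0, S1 under the damped one.
   The constants 8/1000 and 11/100 are what the isentropic condition leaves for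
   the drift between the two and for the gate error (isentropic_bounds). *)
Variables (m : nat) (t : R) (P Q : 'M[C]_n) (F0 F1 S0 S1 : 'M[C]_(n, m)).
Hypotheses (t_ge0 : 0 <= t) (P_proj : is_proj P) (Q_proj : is_proj Q).
Hypotheses (PQ0 : P *m Q = 0) (F1E : F1 = mexp A t *m F0) (F0_unit : frob F0 = 1).
Hypotheses (S0F0 : frob (S0 - F0) <= 8 / 1000) (S1F1 : frob (S1 - F1) <= 8 / 1000).
Hypothesis leak0 : frob (S0 - P *m S0) <= 11 / 100 * frob S0.
Hypothesis leak1 : frob (S1 - Q *m S1) <= 11 / 100 * frob S1.

Lemma F1_unit : frob F1 = 1.
Proof. by rewrite F1E frob_mexp ?iH_antiherm. Qed.

Let S0_bounds := frob_near_unit F0_unit S0F0.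

(** The damped leak plus the drift: 0.11 * 1.008 + 0.008 < 0.119. *)
Lemma F0_leak : frob (F0 - P *m F0) <= 119 / 1000.
Proof.
have := frob_compl_near F0 S0 P_proj; have /andP[_] := S0_bounds.
by move: S0F0 leak0; lra.
Qed.

Lemma F1_leak : frob (F1 - Q *m F1) <= 119 / 1000.
Proof.
have := frob_compl_near F1 S1 Q_proj; have := frobB_le S1 F1.
by rewrite F1_unit; move: S1F1 leak1; lra.
Qed.

(** The overlap of F0 and F1 is at most 2 * 0.119 by orthogonality of the gates and at least 1 - t
    <H>. *)
Lemma gate_time_energy : gram H -> 76 / 100 <= t * rip F0 (H *m F0).
Proof.
move=> gH; have := overlap_ge_energy F0 gH t_ge0; rewrite -F1E.
have := rip_le_orthogonal_proj F0 F1 P_proj Q_proj PQ0.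
rewrite F1_unit F0_unit mulr1 mul1r -sqr_frob F0_unit expr1n.
by have := F0_leak; have := F1_leak; lra.
Qed.

(** Stated for the damped [S0], since the semi-classical condition concerns the actual state. Its
    evolved copy leaks at most 0.119 + 0.008 = 0.127, and 0.89 s^2 - 0.127 s >= 0.7 s^2 for s = |S0|
    >= 0.992. *)
Lemma gate_time_spread h :
  7 / 10 * frob S0 ^+ 2 <= t * (frob (H *m S0 - h%:C *: S0) * frob S0).
Proof.
pose X1 := phase h t *: (mexp A t *m S0).
have := overlap_ge_spread S0 h t_ge0; rewrite -/X1.
have nX1 : frob X1 = frob S0.
  by rewrite /X1 frob_unimodular ?norm_phase // frob_mexp // iH_antiherm.
have lX1 : frob (X1 - Q *m X1) <= 127 / 1000.
  rewrite /X1 -scalemxAr -scalerBr frob_unimodular ?norm_phase //.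
  have := frob_compl_near (mexp A t *m S0) F1 Q_proj.
  rewrite {3}F1E -mulmxBr (frob_mexp _ _ iH_antiherm).
  rewrite [frob (F0 - S0)]frobBC.
  by have := F1_leak; move: S0F0; lra.
have := rip_le_orthogonal_proj S0 X1 P_proj Q_proj PQ0.
rewrite nX1 -sqr_frob; have /andP[] := S0_bounds; move: lX1 leak0.
have := frob_ge0 (S0 - P *m S0); have := frob_ge0 (X1 - Q *m X1).
move: (frob (X1 - _)) (frob (S0 - P *m _)) (frob S0) (rip S0 X1) (t * _).
by move=> a b c d e; nra.
Qed.

End SpeedLimits.

(** * Gates in the isentropic interval *)
Section GateBounds.
Variable R : realType.
Local Notation C := R[i].
Local Notation Re := (@complex.Re R).
Local Notation Im := (@complex.Im R).

(** As 4 * 5.6^2 > 125, the right side is at most 0.008. Both its terms are nonnegative; e <= 1/2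
    gives 2 - e >= 3/2 and a square root of at least 1/2. *)
Lemma isentropic_bounds (e q : R) : 0 <= e <= 2^-1 -> 0 <= q ->
  (4 * (1 + lambda464 R) ^+ 2)^-1 = e * (2 - e) + 2 * q * Num.sqrt (1 - e) ->
  2 * e <= (11 / 100) ^+ 2 /\ q <= 8 / 1000.
Proof.
move=> /andP[e0 e1] q0; set s := Num.sqrt _.
have s0 : 0 <= s by exact: sqrtr_ge0.
have s2 : s ^+ 2 = 1 - e by rewrite sqr_sqrtr //; lra.
have s1 : 1 / 2 <= s by rewrite leNgt; apply/negP => lt; nra.
have l56 : 56 / 10 <= 1 + lambda464 R by rewrite /lambda464; lra.
set x := 4 * _ => E.
have x125 : 125 <= x by rewrite /x; nra.
have xV : x^-1 <= 8 / 1000 by rewrite -div1r ler_pdivrMr; lra.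
rewrite E in xV.
have qs : q <= 2 * q * s by nra.
have es : 3 / 2 * e <= e * (2 - e) by nra.
by split; lra.
Qed.

(** In terms of x = T0/t1 and k <= 0.6: S >= 0.76 x gives the linear bound. If moreover 0.7 x^2 <=
    1, then x <= 1.2 and k^2 x^2 <= 0.432 x <= S. *)
Lemma frequency_bounds (T0 t1 S en : R) : 0 < T0 -> 0 < t1 ->
  T0 * en <= S -> 76 / 100 <= t1 * en ->
  t1^-1 <= S / ((lambda464 R + 1) * (1 / 10) * T0) /\
  (7 / 10 * T0 ^+ 2 <= t1 ^+ 2 ->
   t1^-1 <= Num.sqrt S / ((lambda464 R + 1) * (1 / 10) * T0)).
Proof.
move=> T0p t1p eS te.
have [k0 k1] : 0 < (lambda464 R + 1) * (1 / 10) /\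
    (lambda464 R + 1) * (1 / 10) <= 6 / 10.
  by rewrite /lambda464; split; lra.
move: (_ * (1 / 10)) k0 k1 => k k0 k1.
have dp : 0 < k * T0 by exact: mulr_gt0.
have t1n : t1 != 0 by rewrite gt_eqF.
pose x := T0 / t1; have x0 : 0 < x by rewrite divr_gt0.
have Sx : 76 / 100 * x <= S.
  apply: le_trans eS; rewrite mulrA ler_pdivrMr // [leLHS]mulrC -mulrA ler_pM2l //.
  by rewrite [en * _]mulrC.
have E : t1^-1 * (k * T0) = k * x by rewrite mulrC mulrA.
split=> [|sc]; rewrite ler_pdivlMr // E; first by clearbody x; nra.
have x2 : 7 / 10 * x ^+ 2 <= 1.
  by rewrite expr_div_n mulrA ler_pdivrMr ?exprn_gt0 // mul1r.
rewrite -[leLHS]ger0_norm; last by rewrite ltW // mulr_gt0.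
rewrite -sqrtr_sqr ler_wsqrtr //; apply: le_trans Sx.
have x1 : x <= 12 / 10 by rewrite leNgt; apply/negP => lt; clearbody x; nra.
have kk : k ^+ 2 <= 36 / 100 by nra.
rewrite exprMn; apply: le_trans (ler_wpM2r (sqr_ge0 x) kk) _.
by clearbody x; nra.
Qed.

Lemma frobZ m n (a : R) (X : 'M[C]_(m, n)) : 0 <= a -> frob (a%:C *: X) = a * frob X.
Proof.
move=> a0; apply/eqP; rewrite -(@eqrXn2 _ 2) ?mulr_ge0 ?frob_ge0 //.
by rewrite exprMn !sqr_frob ripZl ripZr mulrA.
Qed.

Variables (dL dR dC : nat).
Local Notation dSC := (dL * dR * dC)%N.

Lemma liftLM (A B : 'M[C]_dL) :
  liftL dR dC A *m liftL dR dC B = liftL dR dC (A *m B).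
Proof. by rewrite /liftL !tensmx_mul !mulmx1. Qed.

Lemma liftL0 : liftL dR dC (0 : 'M[C]_dL) = 0.
Proof. by rewrite /liftL !tens0mx. Qed.

Lemma liftLZ a (A : 'M[C]_dL) : liftL dR dC (a *: A) = a *: liftL dR dC A.
Proof. by rewrite /liftL !tensmxZl. Qed.

Lemma liftL_proj (A : 'M[C]_dL) : is_proj A -> is_proj (liftL dR dC A).
Proof.
move=> [hA AA]; split; last by rewrite liftLM AA.
by apply: herm_tens; [apply: herm_tens|]; rewrite /herm ?dag1.
Qed.

Lemma ketbra_proj k (e : 'I_k -> 'cV[C]_dL) a : orthonormal_fam e ->
  is_proj (ketbra (e a)).
Proof.
by move=> oe; split; [exact: ketbra_herm|rewrite ketbraM // eqxx scale1r].
Qed.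

(** By Pythagoras the squared leak is |S|^2 times the overlap deficit of the normalized logical
    state, which is at most 2e. *)
Lemma gate_leak (x : 'cV[C]_dL) m (S : 'M[C]_(dSC, m)) (e : R) :
  is_proj (ketbra x) -> (dag x *m x) 0 0 = 1 -> 0 < frob S ->
  trdist_le (ptr2 (ptr2 (tr_normalize (S *m dag S)))) (ketbra x) e ->
  2 * e <= (11 / 100) ^+ 2 ->
  frob (S - liftL dR dC (ketbra x) *m S) <= 11 / 100 * frob S.
Proof.
move=> px x1 S0 /(trdist_le_overlap x1) + e2; rewrite !mxtrace_mul_ptr2.
rewrite -/(liftL dR dC (ketbra x)) /tr_normalize tr_gram -fmorphV -scalemxAr.
rewrite mxtraceZ ReCM rip_tr => h; have pL := liftL_proj px.
apply: frob_le; first by rewrite mulr_ge0 ?frob_ge0 //; lra.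
rewrite proj_compl_rip // exprMn -[rip S S]sqr_frob.
have S2 : 0 < frob S ^+ 2 by rewrite exprn_gt0.
move: h; rewrite [_^-1 * _]mulrC ler_pdivlMr //.
by move: (rip S _) (frob S ^+ 2) S2 e2 => r s; nra.
Qed.

(** The coefficients 1 - delta are 0 or 1, so [Mbar] is t1/T0 times a projection. *)
Lemma frob_Mbar_le m (T0 t1 : R) (g : 'I_dL -> 'cV[C]_dL) j (Z : 'M[C]_(dSC, m)) :
  0 < T0 -> 0 < t1 -> orthonormal_fam g ->
  frob (liftL dR dC (Mbar T0 t1 g j) *m Z) <= t1 / T0 * frob Z.
Proof.
move=> T0p t1p og.
pose Q := \sum_(k < dL) (1 - (k.+1 == j)%:R : R)%:C *: ketbra (g k).
have MQ : Mbar T0 t1 g j = (t1 / T0)%:C *: Q.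
  rewrite /Mbar /Q [t1 / T0]mulrC rmorphM -scalerA; congr (_ *: _).
  by rewrite scaler_sumr; apply: eq_bigr => k _; rewrite rmorphM -scalerA.
have pQ : is_proj Q.
  split; first exact: sum_ketbra_herm.
  rewrite /Q sum_ketbraM //; apply: eq_bigr => k _; congr (_ *: _).
  by rewrite -rmorphM; case: (_ == _); rewrite ?subrr ?subr0 ?mulr0 ?mulr1.
have t0 : 0 <= t1 / T0 by rewrite divr_ge0 ?ltW.
rewrite MQ liftLZ -scalemxAl frobZ // ler_wpM2l //.
by apply: frob_proj_le; exact: liftL_proj.
Qed.

(* Matrices with proportional Gram matrices are purifications of the same state. *)
Lemma frob_same_state n p q (M : 'M[C]_n) (X : 'M[C]_(n, p)) (Z : 'M[C]_(n, q))
    (a : R) : 0 <= a -> X *m dag X = (a ^+ 2)%:C *: (Z *m dag Z) ->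
  frob (M *m X) = a * frob (M *m Z).
Proof.
move=> a0 XZ; apply/eqP; rewrite -(@eqrXn2 _ 2) ?mulr_ge0 ?frob_ge0 //.
rewrite exprMn !sqr_frob !rip_mull !mulmxA -!rip_tr XZ -scalemxAr mxtraceZ.
by rewrite ReCM.
Qed.

End GateBounds.

(** * One cycle: damped and unitary purifications [Psi] and [Phi] at the gate times *)

Section Cycle.
Variable R : realType.
Local Notation C := R[i].
Local Notation Re := (@complex.Re R).
Variables (dL dR dC nJ : nat).
Local Notation dSC := (dL * dR * dC)%N.
Variables (Hsc : 'M[C]_dSC) (J : 'I_nJ -> 'M[C]_dC).
Variables (v : 'I_dC -> R) (u : 'I_dC -> 'cV[C]_dC).
Variables (rho0C : 'M[C]_dC) (rhoS0 : 'M[C]_(dL * dR)).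
Variables (E : R -> 'M[C]_dSC -> 'M[C]_dSC) (tau : nat -> R).
Variables (l : nat) (epsg : R) (g : 'I_dL -> 'cV[C]_dL) (t1 tmax : R).
Hypothesis Hsc_herm : herm Hsc.
Hypothesis Hsc_gram : gram Hsc.
Hypothesis u_orth : orthonormal_fam u.
Hypothesis VC_spec : VC J = \sum_(j < dC) (v j)%:C *: ketbra (u j).
Hypothesis E_flow : is_flow (Lnore J Hsc) E.
Hypothesis epsg_range : 0 <= epsg <= 2^-1.
Hypothesis g_orth : orthonormal_fam g.
Hypothesis t1_gt0 : 0 < t1.
Hypothesis tmax_def : is_tmax J E tau rhoS0 rho0C epsg v u l tmax.
Hypothesis gates : forall j : nat, (0 < j)%N -> 0 < j%:R * t1 < tmax ->
  exists k : 'I_dL, k.+1 = j /\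
    trdist_le (stateL J E tau rhoS0 rho0C l (j%:R * t1)) (ketbra (g k)) epsg.
Variables (m : nat) (Y : 'M[C]_(dSC, m)).
Hypothesis initE : init_state J E tau rhoS0 rho0C l = Y *m dag Y.
Hypothesis Y_unit : frob Y = 1.

Local Notation A := (- (iC R *: Hsc)).
Local Notation V := ((1%:M : 'M[C]_(dL * dR)) *t VC J).
Local Notation Psi t := (mexp (A - V) t *m Y).
Local Notation Phi t := (mexp A t *m Y).
Local Notation rho t := (unnorm_state J E tau rhoS0 rho0C l t).

Lemma rhoE t : rho t = Psi t *m dag (Psi t).
Proof.
by rewrite /unnorm_state (flowE Hsc_herm E_flow) initE dagM !mulmxA.
Qed.

(** The sum of v_j^2 p_j is the expectation of V^2, that is |V Psi|^2; this is the integrand that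
    [drift_le] produces. *)
Lemma eps_qualityE t : eps_quality J E tau rhoS0 rho0C v u l t =
  \int[@lebesgue_measure R]_(s in `[0, t]) frob (V *m Psi s).
Proof.
apply: eq_Rintegral => s _; rewrite -[RHS]ger0_norm ?frob_ge0 // -sqrtr_sqr.
congr Num.sqrt; rewrite sqr_frob rip_mull mulmxA -rip_tr -rhoE dag_tens dag1.
rewrite VC_herm tensmx_mul mulmx1 VC_spec sum_ketbraM // tensmx_sumr mulmx_suml.
rewrite [\tr _]raddf_sum /= Re_sum; apply: eq_bigr => j _.
by rewrite tensmxZr -scalemxAl mxtraceZ -rmorphM ReCM expr2.
Qed.

Let quality := isentropic_bounds epsg_range
  (Rintegral_ge0 _ (fun s _ => sqrtr_ge0 _)) tmax_def.2.1.

Lemma drift t : 0 <= t -> t <= tmax -> frob (Psi t - Phi t) <= 8 / 1000.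
Proof.
move=> t0 tT; apply: le_trans quality.2; rewrite -/(eps_quality _ _ _ _ _ _ _ _ _).
rewrite eps_qualityE; exact: drift_le_later.
Qed.

Lemma Phi_unit t : frob (Phi t) = 1.
Proof. by rewrite frob_mexp ?Y_unit //; exact: iH_antiherm. Qed.

Lemma Psi_gt0 t : 0 <= t -> t <= tmax -> 0 < frob (Psi t).
Proof.
move=> t0 tT; have /andP[h _] := frob_near_unit (Phi_unit t) (drift t0 tT).
by apply: lt_le_trans h; lra.
Qed.

Lemma Psi_leak j : (0 < j)%N -> 0 < j%:R * t1 < tmax ->
  exists k : 'I_dL, k.+1 = j /\
    frob (Psi (j%:R * t1) - liftL dR dC (ketbra (g k)) *m Psi (j%:R * t1)) <=
    11 / 100 * frob (Psi (j%:R * t1)).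
Proof.
move=> j0 jt; have /andP[t0 tT] := jt; have [k [kj tr]] := gates j0 jt.
exists k; split => //; apply: (gate_leak (e := epsg)).
- exact: ketbra_proj.
- by rewrite g_orth eqxx.
- by apply: Psi_gt0; exact: ltW.
- by rewrite -rhoE.
- exact: quality.1.
Qed.

Lemma energy_Phi t : rip (Phi t) (Hsc *m Phi t) =
  init_energy J rho0C Hsc E tau rhoS0 l.
Proof.
by rewrite energy_mexp // /init_energy initE rip_tr.
Qed.

Variable j : nat.
Hypotheses (j_gt0 : (1 <= j)%N) (j_tmax : j.+1%:R * t1 < tmax).

Lemma gate_times : 0 < j%:R * t1 < tmax /\ 0 < j.+1%:R * t1 < tmax.
Proof.
rewrite j_tmax !mulr_gt0 ?ltr0n //; split => //=.
by apply: lt_trans j_tmax; rewrite ltr_pM2r // ltr_nat.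
Qed.

Lemma Phi_succ : Phi (j.+1%:R * t1) = mexp A t1 *m Phi (j%:R * t1).
Proof. by rewrite mulmxA -mexpD -natr1 mulrDl mul1r addrC. Qed.

Lemma gate_projections : exists P Q : 'M[C]_dSC,
  [/\ is_proj P, is_proj Q, P *m Q = 0,
   frob (Psi (j%:R * t1) - P *m Psi (j%:R * t1)) <= 11 / 100 * frob (Psi (j%:R * t1)) &
   frob (Psi (j.+1%:R * t1) - Q *m Psi (j.+1%:R * t1)) <=
   11 / 100 * frob (Psi (j.+1%:R * t1))].
Proof.
have [jt jt1] := gate_times; have [k [kj lk]] := Psi_leak j_gt0 jt.
have [k' [kj' lk']] := Psi_leak (ltn0Sn j) jt1.
exists (liftL dR dC (ketbra (g k))), (liftL dR dC (ketbra (g k'))).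
split => //; try by apply: liftL_proj; exact: ketbra_proj.
(* Gate states are indexed from 0, with [k.+1 = j]; equal indices would give j = j + 1. *)
rewrite liftLM ketbraM //; case: eqVneq => [kk|_]; last by rewrite scale0r liftL0.
by move: kj'; rewrite -kk kj => /eqP; rewrite ltn_eqF.
Qed.

Lemma gate_energy : 76 / 100 <= t1 * init_energy J rho0C Hsc E tau rhoS0 l.
Proof.
have [/andP[t0 tT] /andP[t0' tT']] := gate_times.
have [P [Q [pP pQ PQ lP lQ]]] := gate_projections.
rewrite -(energy_Phi (j%:R * t1)).
exact: (gate_time_energy Hsc_herm (ltW t1_gt0) pP pQ PQ Phi_succ (Phi_unit _)
  (drift (ltW t0) (ltW tT)) (drift (ltW t0') (ltW tT')) lP lQ Hsc_gram).
Qed.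

(** With s the norm of (H - h) Z, the eigenvector equation gives T0 s <= t1/T0 and the speed limit
    gives 7/10 <= t1 s; eliminating s yields the claim. *)
Lemma gate_semiclassical (T0 : R) : 0 < T0 ->
  semiclassical (liftL dR dC (Mbar T0 t1 g j)) (T0%:C *: Hsc)
                (cycle_state J E tau rhoS0 rho0C l (j%:R * t1)) ->
  7 / 10 * T0 ^+ 2 <= t1 ^+ 2.
Proof.
move=> T0p /semiclassical_purification[d [Z [lam [mu' [lam1 [ev ZE]]]]]].
have hT : herm (T0%:C *: Hsc) by rewrite /herm dagZ conj_real Hsc_herm.
have [h' spread] := eigen_spread_le hT lam1 ev.
have [/andP[t0 tT] /andP[t0' tT']] := gate_times.
have [P [Q [pP pQ PQ lP lQ]]] := gate_projections.
have S0 := Psi_gt0 (ltW t0) (ltW tT).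
have := gate_time_spread Hsc_herm (ltW t1_gt0) pP pQ PQ Phi_succ (Phi_unit _)
  (drift (ltW t0) (ltW tT)) (drift (ltW t0') (ltW tT')) lP lQ (h' / T0).
set S := Psi (j%:R * t1) in S0 *.
have SZ : S *m dag S = (frob S ^+ 2)%:C *: (Z *m dag Z).
  rewrite -ZE /cycle_state rhoE -/S /tr_normalize tr_gram scalerA mulfV ?scale1r //.
  by rewrite (inj_eq (@complexI R) _ 0) expf_neq0 // gt_eqF.
have Z1 : frob Z = 1.
  have := frob_same_state 1%:M (frob_ge0 S) SZ; rewrite !mul1mx => h.
  by apply: (mulfI (lt0r_neq0 S0)); rewrite -h mulr1.
(* As a single operator the shifted H can be transported by [frob_same_state] from [S] to [Z], whose
   ancillas may differ. The shift is divided by [T0] because [h'] belongs to T0 H. *)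
pose M := Hsc - (h' / T0)%:C%:M.
have ME p (X : 'M[C]_(dSC, p)) : Hsc *m X - (h' / T0)%:C *: X = M *m X.
  by rewrite mulmxBl mul_scalar_mx.
rewrite ME (frob_same_state M (frob_ge0 S) SZ) => sp.
have T0Z : T0 * frob (M *m Z) <= t1 / T0.
  rewrite -(frobZ _ (ltW T0p)) -ME scalerBr scalerA -rmorphM [T0 * _]mulrC.
  rewrite divfK ?gt_eqF // scalemxAl.
  apply: le_trans spread _.
  by have := frob_Mbar_le j Z T0p t1_gt0 g_orth; rewrite Z1 mulr1.
have sp2 : 7 / 10 <= t1 * frob (M *m Z).
  have S2 : 0 < frob S ^+ 2 by rewrite exprn_gt0.
  rewrite -(ler_pM2r S2); apply: le_trans sp _.
  by rewrite le_eqVlt; apply/orP; left; apply/eqP; ring.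
move: T0Z; rewrite ler_pdivlMr // => T0Z.
apply: le_trans (ler_wpM2r (sqr_ge0 T0) sp2) _.
rewrite [leRHS]expr2; apply: le_trans (ler_wpM2l (ltW t1_gt0) T0Z).
by rewrite le_eqVlt; apply/orP; left; apply/eqP; ring.
Qed.

End Cycle.

Theorem theorem5 (R : realType) :
  exists kappa c0 : R, 0 < kappa /\ 0 < c0 /\
  forall (dL dR dC nJ : nat)
    (T0 : R)
    (Hsc : 'M[R[i]]_(dL * dR * dC))
    (J : 'I_nJ -> 'M[R[i]]_dC)
    (v : 'I_dC -> R) (u : 'I_dC -> 'cV[R[i]]_dC)
    (rho0C : 'M[R[i]]_dC) (rhoS0 : 'M[R[i]]_(dL * dR))
    (E : R -> 'M[R[i]]_(dL * dR * dC) -> 'M[R[i]]_(dL * dR * dC))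
    (tau : nat -> R) (M1 : R)
    (HC : 'M[R[i]]_dC) (eps0 : R)
    (l : nat) (epsg : R)
    (g : 'I_dL -> 'cV[R[i]]_dL) (t1 tmax : R),
  (* cycle time *)
  0 < T0 ->
  (* H_SC self-adjoint with smallest eigenvalue 0 *)
  herm Hsc -> eigenvalue Hsc 0 -> (forall a, eigenvalue Hsc a -> 0 <= a) ->
  (* spectral decomposition V_C = sum_j v_j |v_j><v_j| *)
  orthonormal_fam u ->
  VC J = \sum_(j < dC) (v j)%:C *: ketbra (u j) ->
  (* renewal map assumption *)
  density_mx rho0C ->
  (forall sigma : 'M[R[i]]_dC, density_mx sigma ->
     exists c : R, 0 <= c /\ \sum_(j < nJ) J j *m sigma *m dag (J j) = c%:C *: rho0C) ->
  (* initial system cycle_state *)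
  density_mx rhoS0 ->
  (* E t = e^{t L^{no re}} *)
  is_flow (Lnore J Hsc) E ->
  (* renewal times *)
  tau 0%N = 0 -> (forall k, tau k < tau k.+1) ->
  (* P integrates to 1; universally bounded first moments *)
  (forall l' : nat,
     (\int[@lebesgue_measure R]_(t in `[0%R, +oo[) (Pren J E tau rhoS0 rho0C l' t)%:E
        = 1)%E) ->
  (forall l' : nat,
     (\int[@lebesgue_measure R]_(t in `[0%R, +oo[)
          (t * Pren J E tau rhoS0 rho0C l' t)%:E <= M1%:E)%E) ->
  (* instantaneous initial-cycle-cycle_state parameter eps^0_H *)
  herm HC ->
  frob (ptr2 ((Hsc - 1%:M *t HC) *m (1%:M *t rho0C))) * frob (Hsc - 1%:M *t HC)
     * 2 * M1 * T0 <= eps0 ->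
  (* gate error *)
  0 <= epsg <= 2^-1 ->
  (* gate states |1,l>, |2,l>, ... : orthonormal_fam basis of H_L *)
  orthonormal_fam g ->
  0 < t1 ->
  (* isentropic interval *)
  is_tmax J E tau rhoS0 rho0C epsg v u l tmax ->
  (* gates: T(rho_L(t_j + tau_l | tau_l), |j,l>) <= eps^gate for t_j in (0, tmax) *)
  (forall j : nat, (0 < j)%N -> 0 < j%:R * t1 < tmax ->
     exists k : 'I_dL, k.+1 = j /\
       trdist_le (stateL J E tau rhoS0 rho0C l (j%:R * t1)) (ketbra (g k)) epsg) ->
  (* gates are actually applied during the interval *)
  (exists j : nat, (1 <= j)%N /\ j.+1%:R * t1 < tmax) ->
  (* Case 1 *)
  ((exists j : nat, (1 <= j)%N /\
      0 <= j%:R * t1 < tmax /\ 0 <= j.+1%:R * t1 < tmax /\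
      semiclassical (liftL dR dC (Mbar T0 t1 g j)) (T0%:C *: Hsc)
                    (cycle_state J E tau rhoS0 rho0C l (j%:R * t1)) /\
      semiclassical (liftL dR dC (Mbar T0 t1 g j.+1)) (T0%:C *: Hsc)
                    (cycle_state J E tau rhoS0 rho0C l (j.+1%:R * t1))) ->
   t1^-1 <= Num.sqrt (T0 ^+ 2 * Pin J E tau rhoS0 rho0C T0 Hsc l + eps0)
              / ((lambda464 R + 1) * c0 * T0)) /\
  (* Case 2 *)
  t1^-1 <= (T0 ^+ 2 * Pin J E tau rhoS0 rho0C T0 Hsc l + eps0)
              / ((lambda464 R + 1) * kappa * T0).
Proof.
(* This choice makes (lambda + 1) / 10 = 0.564 <= 0.6, the margin used in [frequency_bounds]. *)
exists (1 / 10), (1 / 10); split; first by lra.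
split; first by lra.
move=> dL dR dC nJ T0 Hsc J v u rho0C rhoS0 E tau M1 HC eps0 l epsg g t1 tmax.
move=> T0p hH _ eH ou VCE rho0 ren rhoS fl _ _ iP iM _ heps eg og t1p htm gates.
move=> [j [j1 jt]].
have gH := herm_eigenvalue_ge0_gram hH eH.
have [m [Y initE]] := gram_init rho0 hH fl tau rhoS l.
have Y1 : frob Y = 1.
  have := tr_init rho0 ren hH fl rhoS iP l; rewrite initE tr_gram => -[/eqP].
  by rewrite sqrp_eq1 ?frob_ge0 // => /eqP.
have eP := init_energy_le_Pin rho0 ren hH fl rhoS iP T0p gH (iM l) heps.
have ge := gate_energy hH gH ou VCE fl eg og t1p htm gates initE Y1 j1 jt.
have [b2 b1] := frequency_bounds T0p t1p eP ge.
split=> // -[i [i1 [_ [/andP[_ it] [sc _]]]]]; apply: b1.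
exact: (gate_semiclassical hH ou VCE fl eg og t1p htm gates initE Y1 i1 it T0p sc).
Qed.
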